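(* Let $G$ be a subcubic multigraph. (a) If $\mathrm{mad}(G)<2$, then $\chi'_s(G)\le 4$ and the bound is tight. (b) If $\mathrm{mad}(G)<24/11$, then $\chi'_s(G)\le 5$. (c) If $\mathrm{mad}(G)<5/2$, then $\chi'_s(G)\le 6$.
   Context: All multigraphs are finite and loopless (parallel edges allowed). A multigraph is subcubic if its maximum degree is at most three, where the degree of a vertex is the number of edges incident with it (parallel edges counted with multiplicity). A star $k$-edge-coloring of a multigraph $G$ is a proper edge-coloring $c:E(G)\to\{1,\dots,k\}$ (edges sharing an endpoint, including parallel edges, get distinct colors) such that no path of length four (four edges) and no cycle of length four in $G$ is bi-colored, i.e. has its edges colored with only two colors. The star chromatic index $\chi'_s(G)$ is the smallest integer $k$ such that $G$ admits a star $k$-edge-coloring. The maximum average degree $\mathrm{mad}(G)$ is the maximum of $2e(H)/|H|$ over all subgraphs $H$ of $G$ (with at least one vertex), where $e(H)$ is the number of edges (with multiplicity) and $|H|$ the number of vertices of $H$. *)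

(* Defs.v *)
From mathcomp Require Import all_boot all_order all_algebra.

Set Implicit Arguments.
Unset Strict Implicit.
Unset Printing Implicit Defensive.

Import Order.TTheory GRing.Theory Num.Theory.

(* Two-element sets of endpoints exclude loops; distinct edges may have the
   same endpoints. *)
Record multigraph := Multigraph {
  vertex : finType;
  edge : finType;
  ends : edge -> {set vertex};
  card_ends : forall e : edge, #|ends e| = 2
}.

Definition degree (G : multigraph) (v : vertex G) : nat :=
  #|[set e : edge G | v \in ends e]|.

Definition max_degree (G : multigraph) : nat := \max_(v : vertex G) degree v.

Definition subcubic (G : multigraph) : bool := max_degree G <= 3.

Definition is_subgraph (G : multigraph)
    (A : {set vertex G}) (B : {set edge G}) : bool :=
  [forall e in B, ends e \subset A].

(* The default value 0 is only reached when G has no vertex, as all the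
   averages are nonnegative. *)
Definition mad (G : multigraph) : rat :=
  \big[Num.max/0%R]_(H : {set vertex G} * {set edge G}
                   | (H.1 != set0) && is_subgraph H.1 H.2)
    ((2 * #|H.2|)%:R / #|H.1|%:R)%R.

Definition is_path (G : multigraph) (n : nat)
    (v : n.+1.-tuple (vertex G)) (e : n.-tuple (edge G)) : bool :=
  uniq v &&
  [forall i : 'I_n, ends (tnth e i) ==
     [set tnth v (widen_ord (leqnSn n) i); tnth v (lift ord0 i)]].

(* [ordS] is the cyclic successor on 'I_n. *)
Definition is_cycle (G : multigraph) (n : nat)
    (v : n.-tuple (vertex G)) (e : n.-tuple (edge G)) : bool :=
  [&& uniq v, uniq e &
   [forall i : 'I_n, ends (tnth e i) == [set tnth v i; tnth v (ordS i)]]].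

Definition proper_coloring (G : multigraph) (k : nat)
    (c : {ffun edge G -> 'I_k}) : bool :=
  [forall e, forall f,
     (e != f) && (ends e :&: ends f != set0) ==> (c e != c f)].

Definition bicolored (G : multigraph) (k : nat)
    (c : {ffun edge G -> 'I_k}) (s : seq (edge G)) : bool :=
  #|[set c e | e in s]| <= 2.

Definition star_coloring (G : multigraph) (k : nat)
    (c : {ffun edge G -> 'I_k}) : bool :=
  [&& proper_coloring c,
      [forall v : 5.-tuple (vertex G), forall e : 4.-tuple (edge G),
         is_path v e ==> ~~ bicolored c e] &
      [forall v : 4.-tuple (vertex G), forall e : 4.-tuple (edge G),
         is_cycle v e ==> ~~ bicolored c e]].

Definition star_colorable (G : multigraph) (k : nat) : bool :=
  [exists c : {ffun edge G -> 'I_k}, star_coloring c].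

Lemma path_uniq_edges (G : multigraph) (n : nat)
    (v : n.+1.-tuple (vertex G)) (e : n.-tuple (edge G)) :
  is_path v e -> uniq e.
Proof.
case/andP=> /tuple_uniqP v_inj /forallP vE; apply/tuple_uniqP.
suff lt_neq (i j : 'I_n) : i < j -> tnth e i != tnth e j.
  move=> i j eij; apply: val_inj => /=; case: (ltngtP i j) => // /lt_neq.
    by rewrite eij eqxx.
  by rewrite eij eqxx.
move=> lt_ij; apply/eqP => eij.
have: tnth v (widen_ord (leqnSn n) i) \in ends (tnth e j).
  by rewrite -eij (eqP (vE i)) set21.
rewrite (eqP (vE j)) !inE => /orP[] /eqP /v_inj /(congr1 val) /= def_i.
  by rewrite def_i ltnn in lt_ij.
by rewrite def_i /bump /= ltnNge leqnSn in lt_ij.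
Qed.

Lemma star_colorable_exists (G : multigraph) :
  exists k : nat, star_colorable G k.
Proof.
exists #|edge G|; apply/existsP; exists [ffun e => enum_rank e].
have rainbow (e : 4.-tuple (edge G)) : uniq e ->
    ~~ bicolored [ffun e => enum_rank e] e.
  move=> uniq_e; rewrite /bicolored card_imset.
    by rewrite (card_uniqP uniq_e) size_tuple.
  by move=> x y; rewrite !ffunE => /enum_rank_inj.
apply/and3P; split; apply/forallP => v; apply/forallP => e; apply/implyP.
- by case/andP=> ne_ve _; rewrite !ffunE (inj_eq enum_rank_inj).
- by move/path_uniq_edges/rainbow.
- by case/and3P=> _ /rainbow.
Qed.

Definition star_chromatic_index (G : multigraph) : nat :=
  ex_minn (star_colorable_exists G).

(* Main.v *)
(* Since the bounds on mad are at least 2, every vertex may be completed to degree three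
   by pendant edges, so that a coloring gives a set S(v) of exactly three colors to
   every vertex; it is a star coloring iff for no path u-v-w both c(vw) is in S(u)
   and c(uv) is in S(w).  Vertices are classified by their number of non-pendant
   edges ("links").  An edge uv with S(u) and S(v) meeting only in c(uv) is safe:
   no bad path goes through it.

   4 colors, forests: record the color m(v) missing at v, and require m(u) <> m(v) on
   every link and exactly one of m(u) = c(vw), m(w) = c(uv) on every path u-v-w; such
   a coloring extends to a new end vertex.

   5 colors: in a minimal counterexample no vertex has one link, there is no double
   edge at a vertex with two links, and there are no four consecutive vertices with
   two links (color so that every other edge of the thread is safe).  So a vertex
   with three links serves at most nine ends of vertices with two links, which
   contradicts mad < 24/11.

   6 colors: moreover no two vertices with two links are adjacent, and no vertex has
   three neighbors with two links, which contradicts mad < 5/2. *)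
Require Import Defs.
From mathcomp Require Import all_boot all_order all_algebra.
From mathcomp Require Import zify.

Set Implicit Arguments.
Unset Strict Implicit.
Unset Printing Implicit Defensive.

Import Order.TTheory GRing.Theory Num.Theory.

(** Reductions cut edges instead of deleting vertices: an edge meeting a set [X] is replaced by a
    pendant edge at each of its ends. All vertices keep degree three, sparsity is inherited, and the
    number of linked darts drops, which drives the induction. A neighbor z of [X] keeps its whole
    triple S(z), including the color of its cut edge; when that edge is glued back it takes this
    color. So the triples outside [X] do not change (except that [free_port] may first recolor one
    cut edge), and only paths meeting [X] have to be checked.

    This is where the numbers of colors enter. With five colors, two are unseen at an outer neighbor
    z; given to the two other edges of its neighbor x in [X], they make xz safe and so shield the
    rest of the graph from [X]. With six colors three are unseen, and the spare choice handles
    vertices none of whose edges is made safe: the center of a claw, or one end of a thread of two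
    vertices. *)

Lemma pick_avoid (T : finType) (A : {set T}) (r : seq T) :
  size r < #|A| -> exists2 x, x \in A & x \notin r.
Proof.
move=> lt_rA; have /existsP[x /andP[Ax rx]] : [exists x, (x \in A) && (x \notin r)].
  apply: contraLR lt_rA => /existsPn nA; rewrite -leqNgt.
  apply: leq_trans (card_size r); apply: subset_leq_card.
  by apply/subsetP=> x Ax; have := nA x; rewrite Ax /= negbK.
by exists x.
Qed.

Lemma pick_color (k : nat) (r : seq 'I_k) : size r < k -> exists x, x \notin r.
Proof.
move=> lt_rk; have [|x _ xr] := @pick_avoid _ [set: 'I_k] r; last by exists x.
by rewrite cardsT card_ord.
Qed.

Lemma uniq3 (T : eqType) (a b c : T) :
  a != b -> a != c -> b != c -> uniq [:: a; b; c].
Proof. by rewrite /= !inE negb_or => -> -> ->. Qed.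

Lemma mem_notin (T : finType) (A : {set T}) a b : a \in A -> b \notin A -> a != b.
Proof. by move=> aA; apply: contraNneq => <-. Qed.

Lemma uniq_swap3 (T : eqType) (i j l : T) : uniq [:: j; i; l] = uniq [:: i; j; l].
Proof. by rewrite /= !inE (eq_sym j) !negb_or !andbT -!andbA; congr (_ && _); rewrite andbC. Qed.

Lemma ord3_cases (i j l m : 'I_3) : uniq [:: i; j; l] -> [\/ m = i, m = j | m = l].
Proof.
move=> u3; have: m \in [:: i; j; l].
  have sub: {subset [:: i; j; l] <= enum 'I_3} by move=> x; rewrite mem_enum.
  have [|_ ->] := uniq_min_size u3 sub; last by rewrite mem_enum.
  by rewrite -cardE card_ord.
by rewrite !inE => /or3P[] /eqP ->; [constructor 1|constructor 2|constructor 3].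
Qed.

Lemma ord3_others (i : 'I_3) : exists j l, uniq [:: i; j; l].
Proof.
have [|j] := @pick_color _ [:: i]; first by [].
rewrite inE => ji; have [|l] := @pick_color _ [:: i; j]; first by [].
rewrite !inE negb_or => /andP[li lj]; exists j, l.
by rewrite /= !inE negb_or (eq_sym i j) (eq_sym i l) (eq_sym j l) ji li lj.
Qed.

(** * Dart graphs, their colorings, and gluing after a cut *)

Section DartGraphs.

Variable V : finType.
Notation dart := (V * 'I_3)%type.
Implicit Types (s : dart -> dart) (d e : dart) (v x : V) (X : {set V}).

(* The dart [(v, i)] is the [i]-th edge-end at [v]; [s] exchanges the two ends of an
   edge and fixes the darts of pendant edges, whose other ends are left implicit. *)
Definition pairing s := involutive s /\ forall d, (s d).1 = d.1 -> s d = d.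

Definition linked s d := s d != d.

Definition links s v := #|[set i | linked s (v, i)]|.

(** Both darts of an edge meeting [X] become fixed points, so the edge survives as two pendant edges
    whose colors are independent of each other. *)
Definition cut s X d := if (d.1 \in X) || ((s d).1 \in X) then d else s d.

Section Colorings.

Variable k : nat.
Implicit Types c f : dart -> 'I_k.

Definition seen c v := [set c (v, i) | i : 'I_3].

Definition clash s c d e :=
  (c e \in seen c (s d).1) && (c d \in seen c (s e).1).

(** Parallel links are excluded: each of their colors is seen at the common far end, yet they form
    no path u-v-w. *)
Definition pair_at s d e :=
  [&& d.1 == e.1, d != e, linked s d, linked s e & (s d).1 != (s e).1].

Definition dart_coloring s c :=
  [/\ forall d, c (s d) = c d,
      forall d e, d.1 = e.1 -> c d = c e -> d = e &
      forall d e, pair_at s d e -> ~~ clash s c d e].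

Definition safe s c d :=
  forall a, a \in seen c d.1 -> a \in seen c (s d).1 -> a = c d.

Lemma mem_seen c d : c d \in seen c d.1.
Proof. by case: d => v i; apply: imset_f. Qed.

Lemma seenP c v a : reflect (exists i, a = c (v, i)) (a \in seen c v).
Proof. by apply: (iffP imsetP) => [[i _ ->]|[i ->]]; exists i. Qed.

Lemma eq_seen c f v : (forall i, c (v, i) = f (v, i)) -> seen c v = seen f v.
Proof. by move=> cf; apply: eq_imset. Qed.

Lemma seen3 c v (i j l : 'I_3) :
  uniq [:: i; j; l] -> seen c v = [set c (v, i); c (v, j); c (v, l)].
Proof.
move=> u3; apply/setP=> a; apply/seenP/idP => [[m ->]|].
  by case: (ord3_cases m u3) => ->; rewrite !inE eqxx ?orbT.
by rewrite !inE -orbA => /or3P[] /eqP ->; [exists i|exists j|exists l].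
Qed.

Lemma card_seen s c v : dart_coloring s c -> #|seen c v| = 3.
Proof.
case=> _ injc _; rewrite card_imset ?card_ord // => i j /injc -/(_ erefl).
by case.
Qed.

Lemma clashC s c d e : clash s c d e = clash s c e d.
Proof. exact: andbC. Qed.

Lemma pair_atC s d e : pair_at s d e = pair_at s e d.
Proof.
by apply/and5P/and5P=> -[? ? ? ? ?]; split; rewrite // eq_sym.
Qed.

Lemma safe_flip s c d : pairing s -> c (s d) = c d -> safe s c (s d) -> safe s c d.
Proof. by move=> [sK _] cs sd a ? ?; rewrite -cs; apply: sd; rewrite ?sK. Qed.

(** Since [c e] is seen at [d.1], a clash would make it seen at both ends of [d]; safety then gives
    [c e = c d], against properness. *)
Lemma safe_no_clash s c d e :
  (forall d e, d.1 = e.1 -> c d = c e -> d = e) ->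
  d.1 = e.1 -> d != e -> safe s c d -> ~~ clash s c d e.
Proof.
move=> injc de ne_de sd; apply/andP=> -[ce _].
have eq_c := sd _ _ ce; rewrite de mem_seen in eq_c.
by rewrite (injc e d) ?eqxx ?eq_c in ne_de.
Qed.

Lemma linked_edge s d : pairing s -> linked s (s d) = linked s d.
Proof. by case=> sK _; rewrite /linked sK eq_sym. Qed.

Lemma pairing_cut s X : pairing s -> pairing (cut s X).
Proof.
case=> sK s_loop; split=> d; rewrite /cut; last by case: ifP => // _; apply: s_loop.
by case E: ((d.1 \in X) || ((s d).1 \in X)); rewrite ?E // sK orbC E.
Qed.

(* Edges meeting X are glued back after X has been recolored: [c] is the
   coloring of the cut graph, [f] the new one. *)
Lemma recolored_gluing s X c f :
  pairing s -> dart_coloring (cut s X) c ->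
  (forall d, d.1 \notin X -> f d = c d) ->
  (forall d, d.1 \in X -> f (s d) = f d) ->
  (forall v, v \in X -> injective (fun i => f (v, i))) ->
  (forall d e, pair_at s d e -> (d.1 \in X) || ((s d).1 \in X) -> ~~ clash s f d e) ->
  dart_coloring s f.
Proof.
move=> [sK s_loop] [cs injc clash_c] fc fs injf clash_f.
have fcs v : v \notin X -> seen f v = seen c v.
  by move=> vX; apply: eq_seen => i; apply: fc.
split=> [d|[v i] [w j] /= <-|d e de].
- case: (boolP (d.1 \in X)) => [/fs // | dX].
  case: (boolP ((s d).1 \in X)) => [/fs | sdX]; first by rewrite sK.
  by have := cs d; rewrite !fc // /cut (negPf dX) (negPf sdX).
- case: (boolP (v \in X)) => [/injf injv /injv -> // | vX].
  by rewrite !fc // => /injc; apply.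
- case: (boolP ((d.1 \in X) || ((s d).1 \in X))) => [|dX]; first exact: clash_f.
  case: (boolP ((s e).1 \in X)) => [seX | seX].
    by rewrite clashC clash_f ?seX ?orbT // pair_atC.
  move: (de) => /and5P[/eqP eq_de ? ld le ?].
  move: dX; rewrite negb_or => /andP[dX sdX].
  have eX : e.1 \notin X by rewrite -eq_de.
  have := clash_c d e; rewrite /pair_at /clash /linked /cut.
  rewrite !(negPf dX) !(negPf eX) (negPf sdX) (negPf seX) /= !fc // !fcs //.
  by apply.
Qed.

(** At a vertex of [X] one safe dart in each pair is enough. At an outside vertex a pair is affected
    only through a link into [X], and such links are safe by the last hypothesis. *)
Lemma safe_gluing s X c f :
  pairing s -> dart_coloring (cut s X) c ->
  (forall d, d.1 \notin X -> f d = c d) ->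
  (forall d, d.1 \in X -> f (s d) = f d) ->
  (forall v, v \in X -> injective (fun i => f (v, i))) ->
  (forall d e, pair_at s d e -> d.1 \in X -> safe s f d \/ safe s f e) ->
  (forall d, d.1 \in X -> (s d).1 \notin X -> safe s f d) ->
  dart_coloring s f.
Proof.
move=> ps cc fc fs injf safe_in safe_out.
have inj_f d e : d.1 = e.1 -> f d = f e -> d = e.
  case: d e => [v i] [w j] /= <-; case: (boolP (v \in X)) => [/injf injv /injv -> // | vX].
  by have [_ injc _] := cc; rewrite !fc // => /injc; apply.
apply: (recolored_gluing ps cc) => // d e pde; have /and5P[/eqP de ne_de ld le _] := pde.
case: (boolP (d.1 \in X)) => [dX _ | dX sdX].
  have [sf | sf] := safe_in d e pde dX; first exact: safe_no_clash.
  by rewrite clashC; apply: safe_no_clash; rewrite // eq_sym.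
apply: safe_no_clash => //; have [sK _] := ps.
have fsd : f (s d) = f d by have := fs (s d) sdX; rewrite sK => ->.
by apply: safe_flip => //; apply: safe_out; rewrite ?sK.
Qed.

(** Only the triple at [u] changes, and it only gains [b]. A new clash would need an edge of color
    [b] at a neighbor of [u], which the last hypothesis forbids. *)
Lemma recolor s c u i b :
  pairing s -> dart_coloring s c -> ~~ linked s (u, i) ->
  (forall j, j != i -> c (u, j) != b) ->
  (forall d, d.1 = u -> linked s d -> b \notin seen c (s d).1) ->
  dart_coloring s (fun d => if d == (u, i) then b else c d).
Proof.
set f := (fun d => _); move=> [sK s_loop] [cs injc clash_c] ui bu bs.
have sui : s (u, i) = (u, i) by apply/eqP; rewrite -[_ == _]negbK.
have fc d : linked s d -> f d = c d.
  by rewrite /f; case: eqP => // ->; rewrite (negPf ui).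
have fv v : v != u -> seen f v = seen c v.
  move=> vu; apply: eq_seen => j; rewrite /f; case: eqP => // -[vE _].
  by rewrite vE eqxx in vu.
have fu a : a \in seen f u -> a = b \/ a \in seen c u.
  case/seenP=> j ->; rewrite /f; case: ifP => _; first by left.
  by right; rewrite -[u in seen c u]/((u, j).1) mem_seen.
split=> [d|d e de|d e de].
- case: (boolP (linked s d)) => [ld | /negPn/eqP -> //].
  by rewrite !fc // linked_edge.
- have bE (j : 'I_3) : c (u, j) = b -> j = i.
    by move=> cj; apply/eqP; apply: contraTT isT => /bu; rewrite cj eqxx.
  rewrite /f; case: (eqVneq d (u, i)) de => [-> /=|du de].
    by case: e => w j /= <-; case: eqVneq => // _ /esym /bE ->.
  case: eqVneq => [eE | _]; last exact: injc.
  by case: d de du => w j /=; rewrite eE /= => -> _ /bE ->.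
(* The two far ends differ, so at most one of them is [u]; by symmetry it is that of [d]. *)
wlog sdu: d e de / (s e).1 != u.
  move=> wl; case: (eqVneq (s e).1 u) => [se | /wl]; last exact.
  rewrite clashC; apply: wl; first by rewrite pair_atC.
  by case/and5P: de => _ _ _ _; rewrite se.
have := clash_c d e de; case/and5P: de => /eqP de ne_de ld le ne_ends.
rewrite /clash !fc //; apply: contra => /andP[]; rewrite (fv _ sdu) => ce ->; rewrite andbT.
case: (eqVneq (s d).1 u) => [sd | /fv <- //]; rewrite sd in ce *.
have [cb | //] := fu _ ce; have := bs (s d) sd.
by rewrite linked_edge // sK de -cb mem_seen; move=> /(_ ld).
Qed.

Definition tri (i j : 'I_3) (a b z : 'I_k) m :=
  if m == i then a else if m == j then b else z.

Lemma triE i j l a b z : uniq [:: i; j; l] ->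
  (tri i j a b z i = a) * (tri i j a b z j = b) * (tri i j a b z l = z).
Proof.
rewrite /= !inE negb_or andbT /tri !eqxx => /andP[/andP[ij il] jl].
by rewrite !(eq_sym _ i) !(eq_sym l) (negPf ij) (negPf il) (negPf jl).
Qed.

Lemma tri_inj i j l a b z :
  uniq [:: i; j; l] -> uniq [:: a; b; z] -> injective (tri i j a b z).
Proof.
move=> u3; rewrite /= !inE negb_or andbT => /andP[/andP[ab az] bz] m n.
case: (ord3_cases m u3) => ->; case: (ord3_cases n u3) => ->;
  rewrite !(triE _ _ _ u3) // => eqc; by move: ab az bz; rewrite ?eqc ?eqxx.
Qed.

Lemma seen_tri f v i j l a b z : uniq [:: i; j; l] ->
  (forall m, f (v, m) = tri i j a b z m) -> seen f v = [set a; b; z].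
Proof. by move=> u3 fE; rewrite (seen3 _ _ u3) !fE !(triE _ _ _ u3). Qed.

End Colorings.

Lemma links3 s v (i j l : 'I_3) : uniq [:: i; j; l] ->
  links s v = linked s (v, i) + linked s (v, j) + linked s (v, l).
Proof.
move=> u3; rewrite /links -sum1dep_card big_mkcond /=.
have [_ ijl] : (size [:: i; j; l] = size (enum 'I_3)) * ([:: i; j; l] =i enum 'I_3).
  by apply: uniq_min_size; rewrite // -?cardE ?card_ord // => m; rewrite mem_enum.
rewrite -big_enum (perm_big [:: i; j; l]) /=; last first.
  by apply: uniq_perm; rewrite ?enum_uniq // => m; rewrite ijl.
by rewrite !big_cons big_nil addn0 addnA.
Qed.

Lemma ports1 s v i : links s v <= 1 -> linked s (v, i) ->
  exists j l, [/\ uniq [:: i; j; l], s (v, j) = (v, j) & s (v, l) = (v, l)].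
Proof.
have [j [l u3]] := ord3_others i; rewrite (links3 _ _ u3) => + li; rewrite li.
case lj: (linked s (v, j)) => //; case ll: (linked s (v, l)) => // _.
by exists j, l; split=> //; apply/eqP/negPn; rewrite -/(linked _ _) ?lj ?ll.
Qed.

Lemma ports2 s v i : links s v = 2 -> linked s (v, i) ->
  exists j l, [/\ uniq [:: i; j; l], linked s (v, j) & s (v, l) = (v, l)].
Proof.
have [j [l u3]] := ord3_others i; rewrite (links3 _ _ u3) => + li; rewrite li.
case lj: (linked s (v, j)); case ll: (linked s (v, l)) => // _.
  by exists j, l; split=> //; apply/eqP/negPn; rewrite -/(linked _ _) ll.
exists l, j; split=> //; last by apply/eqP/negPn; rewrite -/(linked _ _) lj.
by move: u3; rewrite /= !inE !negb_or !andbT andbC (eq_sym l) => /andP[-> /andP[-> ->]].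
Qed.

End DartGraphs.

(** * Reduction of vertices with one link *)

Section Reductions.

Variable V : finType.
Notation dart := (V * 'I_3)%type.
Variable s : dart -> dart.
Hypothesis ps : pairing s.

Lemma linked_ends (d : dart) : linked s d -> (s d).1 != d.1.
Proof. by have [_ s_loop] := ps; apply: contra => /eqP/s_loop/eqP. Qed.

Lemma pairingK d : s (s d) = d. Proof. by have [-> _] := ps. Qed.

Lemma unseen_two k (t : dart -> dart) (c : dart -> 'I_k) (z : V) : 4 < k ->
  dart_coloring t c -> exists a b, [/\ a \notin seen c z, b \notin seen c z & a != b].
Proof.
move=> k5 cc; have := cardsC (seen c z); rewrite (card_seen z cc) card_ord => cardC.
have [|a + _] := @pick_avoid _ (~: seen c z) [::].
  by rewrite -(ltn_add2l 3) cardC (leq_trans _ k5).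
have [|b + ab] := @pick_avoid _ (~: seen c z) [:: a].
  by rewrite -(ltn_add2l 3) cardC.
by rewrite !inE => nb na; exists a, b; split=> //; move: ab; rewrite inE eq_sym.
Qed.

(** The two pendant edges at [y] take colors unseen at its neighbor [z], which makes the only link
    at [y] safe. *)
Lemma pendant_extends k (c : dart -> 'I_k) y i :
  4 < k -> links s y <= 1 -> linked s (y, i) ->
  dart_coloring (cut s [set y]) c -> exists f : dart -> 'I_k, dart_coloring s f.
Proof.
move=> k5 y1 li cc; have [j [l [u3 sj sl]]] := ports1 y1 li.
have := linked_ends li => /= zy.
set z := (s (y, i)).1 in zy.
have [a [b [az bz ab]]] := unseen_two z k5 cc.
pose f d := if d.1 == y then tri i j (c (s (y, i))) a b d.2 else c d.
have fy m : f (y, m) = tri i j (c (s (y, i))) a b m by rewrite /f /= eqxx.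
have fz : seen f z = seen c z.
  by apply: eq_seen => m; rewrite /f /= (negPf zy).
have cz : c (s (y, i)) \in seen c z by apply: mem_seen.
exists f; apply: (safe_gluing ps cc) => [d|[v m]|v|[v m] [w n]|[v m]]; rewrite !inE.
- by rewrite /f => /negPf->.
- move=> /eqP/= ->; case: (ord3_cases m u3) => ->; rewrite ?sj ?sl //.
  by rewrite fy (triE _ _ _ u3) /f (negPf zy).
- move=> /eqP-> m n; rewrite !fy; apply: (tri_inj u3); apply: uniq3 => //.
    exact: mem_notin cz az.
  exact: mem_notin cz bz.
- move=> /and5P[/= /eqP <- mn lm ln _] /eqP vy; move: lm ln mn; rewrite {}vy.
  by case: (ord3_cases m u3) => ->; rewrite /linked ?sj ?sl ?eqxx //;
    case: (ord3_cases n u3) => ->; rewrite ?sj ?sl ?eqxx.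
- move=> /eqP/= ->; case: (ord3_cases m u3) => ->; rewrite ?sj ?sl ?eqxx //= => _.
  move=> p; rewrite (seen_tri u3 fy) fz !inE fy (triE _ _ _ u3).
  by case/orP=> [/orP[]|] /eqP-> //; [move/(negP az) | move/(negP bz)].
Qed.

End Reductions.

(** * Reduction of double edges, and of long or closed threads with five colors *)

Section Reductions.

Variable V : finType.
Notation dart := (V * 'I_3)%type.
Variable s : dart -> dart.
Hypothesis ps : pairing s.

(** The parallel links get two colors unseen at the third neighbor [z] of [v], so that the link from
    [v] to [z] is safe; the parallel links themselves form no pair. *)
Lemma digon_extends k (c : dart -> 'I_k) x j1 j2 :
  4 < k -> links s x = 2 -> j1 != j2 -> linked s (x, j1) -> linked s (x, j2) ->
  (s (x, j1)).1 = (s (x, j2)).1 ->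
  dart_coloring (cut s [set (s (x, j1)).1; x]) c ->
  exists f : dart -> 'I_k, dart_coloring s f.
Proof.
move=> k5 x2 j12 lj1 lj2.
have [j [j3 [u3 lj sj3]]] := ports2 x2 lj1.
have {lj}ej : j2 = j.
  case: (ord3_cases j2 u3) => // ej; first by rewrite ej eqxx in j12.
  by rewrite ej /linked sj3 eqxx in lj2.
subst j; clear j12.
have := linked_ends ps lj1 => /=.
case s1: (s (x, j1)) => [v i1]; case s2: (s (x, j2)) => [w i2] /= vx vw.
rewrite -{w}vw in s2 => cc.
have s1' : s (v, i1) = (x, j1) by rewrite -s1 (pairingK ps).
have s2' : s (v, i2) = (x, j2) by rewrite -s2 (pairingK ps).
have i12 : i1 != i2.
  apply/eqP=> i12; have := u3; rewrite /= inE.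
  by have := s1'; rewrite i12 s2' => -[->]; rewrite eqxx.
have [|i3] := @pick_color _ [:: i1; i2]; first by [].
rewrite !inE negb_or => /andP[i31 i32].
have v3 : uniq [:: i1; i2; i3] by apply: uniq3; rewrite // eq_sym.
(* If port [i3] is pendant, then [z] is [v] and [a] is the old color of that port, so both cases are
   treated alike. *)
set a := c (s (v, i3)); set z := (s (v, i3)).1.
have zx : z != x.
  apply/eqP; rewrite /z; case sv: (s (v, i3)) => [y m] /= yx.
  have sv' : s (x, m) = (v, i3) by rewrite -yx -sv (pairingK ps).
  have := sv'; case: (ord3_cases m u3) => ->; rewrite ?s1 ?s2 ?sj3.
  - by move=> [im]; rewrite im eqxx in i31.
  - by move=> [im]; rewrite im eqxx in i32.
  - by move=> [vE _]; rewrite vE eqxx in vx.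
have az : a \in seen c z by apply: mem_seen.
have [p [q [pz qz pq]]] := unseen_two z k5 cc.
have [g ] := @pick_color k [:: a; p; q] (leq_trans (isT : 3 < 5) k5).
rewrite !inE !negb_or => /and3P[ga gp gq].
pose f d := if d.1 == v then tri i1 i2 p q a d.2 else
            if d.1 == x then tri j1 j2 p q g d.2 else c d.
have fv m : f (v, m) = tri i1 i2 p q a m by rewrite /f /= eqxx.
have fx m : f (x, m) = tri j1 j2 p q g m by rewrite /f /= eqxx eq_sym (negPf vx).
have fsv3 : f (s (v, i3)) = f (v, i3).
  rewrite fv (triE _ _ _ v3) {1}/f -/z (negPf zx) -/a; case: eqP => // zv.
  by have [_ /(_ _ zv)->] := ps; rewrite (triE _ _ _ v3).
have ap : a != p by apply: mem_notin az pz.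
have aq : a != q by apply: mem_notin az qz.
have safe3 : z \notin [set v; x] -> safe s f (v, i3).
  rewrite !inE negb_or => /andP[zv _] b; rewrite -/z.
  have -> : seen f z = seen c z.
    by apply: eq_seen => m; rewrite /f /= (negPf zx) (negPf zv).
  rewrite (seen_tri v3 fv) !inE fv (triE _ _ _ v3) -orbA.
  by case/or3P=> /eqP->; rewrite ?(negPf pz) ?(negPf qz).
exists f; apply: (safe_gluing ps cc) => [d|[y m]|y|[y m] [y' n]|[y m]]; rewrite !inE.
- by rewrite /f negb_or => /andP[/negPf-> /negPf->].
- case/orP=> /= /eqP->.
    by case: (ord3_cases m v3) => -> //; rewrite ?s1' ?s2' fv fx !(triE _ _ _ v3, triE _ _ _ u3).
  by case: (ord3_cases m u3) => ->; rewrite ?s1 ?s2 ?sj3 // fv fx !(triE _ _ _ v3, triE _ _ _ u3).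
- case/orP=> /= /eqP-> m n; rewrite ?fv ?fx; first apply: (tri_inj v3); last apply: (tri_inj u3).
    by apply: uniq3; rewrite // eq_sym.
  by apply: uniq3; rewrite // eq_sym.
- move=> /and5P[/= /eqP <- mn lm ln zz] /orP[] /eqP vy; move: lm ln mn zz; rewrite {}vy.
    have l3 : linked s (v, i3) -> safe s f (v, i3).
      move=> l3; apply: safe3; by have /= zv := linked_ends ps l3; rewrite !inE negb_or zx andbT.
    case: (ord3_cases m v3) => -> l ln; first last.
    + by left; apply: l3.
    + by case: (ord3_cases n v3) ln => -> ln; rewrite ?s1' ?s2' ?eqxx //; right; apply: l3.
    by case: (ord3_cases n v3) ln => -> ln; rewrite ?s1' ?s2' ?eqxx //; right; apply: l3.
  by case: (ord3_cases m u3) => ->; rewrite /linked ?s1 ?s2 ?sj3 ?eqxx //;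
    case: (ord3_cases n u3) => ->; rewrite ?s1 ?s2 ?sj3 ?eqxx.
- case/orP=> /= /eqP->.
    by case: (ord3_cases m v3) => ->; rewrite ?s1' ?s2' ?eqxx ?orbT //= => zX;
      apply: safe3; rewrite !inE.
  by case: (ord3_cases m u3) => ->; rewrite ?s1 ?s2 ?sj3 ?eqxx ?orbT.
Qed.

(** Along the walk u, [x1], [x2], [x3], [x4], w the first, third and fifth edges are made safe, and
    every pair of links at an [x] contains one of them. *)
Lemma thread4_extends (c : dart -> 'I_5) x1 x2 x3 x4 (i1 j1 l1 i2 j2 l2 i3 j3 l3 i4 j4 l4 : 'I_3) :
  uniq [:: x1; x2; x3; x4] ->
  uniq [:: i1; j1; l1] -> uniq [:: i2; j2; l2] -> uniq [:: i3; j3; l3] -> uniq [:: i4; j4; l4] ->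
  s (x1, l1) = (x1, l1) -> s (x2, l2) = (x2, l2) -> s (x3, l3) = (x3, l3) ->
  s (x4, l4) = (x4, l4) ->
  s (x1, j1) = (x2, i2) -> s (x2, j2) = (x3, i3) -> s (x3, j3) = (x4, i4) ->
  (s (x1, i1)).1 \notin [set x1; x2; x3; x4] -> (s (x4, j4)).1 \notin [set x1; x2; x3; x4] ->
  dart_coloring (cut s [set x1; x2; x3; x4]) c ->
  exists f : dart -> 'I_5, dart_coloring s f.
Proof.
move=> ux u1 u2 u3 u4 sl1 sl2 sl3 sl4 s12 s23 s34 uX wX cc.
have s21 : s (x2, i2) = (x1, j1) by rewrite -s12 (pairingK ps).
have s32 : s (x3, i3) = (x2, j2) by rewrite -s23 (pairingK ps).
have s43 : s (x4, i4) = (x3, j3) by rewrite -s34 (pairingK ps).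
set a := c (s (x1, i1)); set u := (s (x1, i1)).1 in uX.
set a' := c (s (x4, j4)); set w := (s (x4, j4)).1 in wX.
have au : a \in seen c u by apply: mem_seen.
have aw : a' \in seen c w by apply: mem_seen.
have [r [r1 [ru r1u rr1]]] := unseen_two u (isT : 4 < 5) cc.
(* Of the two colors unseen at [w], at least one differs from [r]; it becomes [r']. *)
have [r' [r1' [rw r1w rr1' ne_r]]] : exists b d,
    [/\ b \notin seen c w, d \notin seen c w, b != d & b != r].
  have [p [q [pw qw pq]]] := unseen_two w (isT : 4 < 5) cc.
  by case: (eqVneq p r) => [<-|]; [exists q, p; split | exists p, q; split]; rewrite // eq_sym.
have ar : a != r by apply: mem_notin au ru.
have ar1 : a != r1 by apply: mem_notin au r1u.
have ar' : a' != r' by apply: mem_notin aw rw.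
have ar1' : a' != r1' by apply: mem_notin aw r1w.
(* The colors [r], [r'], [t], [b2], [b3] exhaust the five, so the triples [{r, t, b2}] at [x2] and
   [{t, r', b3}] at [x3] meet only in [t]. *)
have [t] := @pick_color 5 [:: r; r'] isT; rewrite !inE negb_or => /andP[tr tr'].
have [b2] := @pick_color 5 [:: r; r'; t] isT; rewrite !inE !negb_or => /and3P[b2r b2r' b2t].
have [b3] := @pick_color 5 [:: r; r'; t; b2] isT; rewrite !inE !negb_or => /and4P[b3r b3r' b3t b3b].
move: ux; rewrite /= !inE !negb_or -!andbA => /and5P[x12 x13 x14 x23 /and3P[x24 x34 _]].
pose f d := if d.1 == x1 then tri i1 j1 a r r1 d.2 else
            if d.1 == x2 then tri i2 j2 r t b2 d.2 else
            if d.1 == x3 then tri i3 j3 t r' b3 d.2 else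
            if d.1 == x4 then tri i4 j4 r' a' r1' d.2 else c d.
have f1 m : f (x1, m) = tri i1 j1 a r r1 m by rewrite /f /= eqxx.
have f2 m : f (x2, m) = tri i2 j2 r t b2 m by rewrite /f /= eqxx eq_sym (negPf x12).
have f3 m : f (x3, m) = tri i3 j3 t r' b3 m.
  by rewrite /f /= eqxx !(eq_sym x3) (negPf x13) (negPf x23).
have f4 m : f (x4, m) = tri i4 j4 r' a' r1' m.
  by rewrite /f /= eqxx !(eq_sym x4) (negPf x14) (negPf x24) (negPf x34).
have fX d : d.1 \notin [set x1; x2; x3; x4] -> f d = c d.
  by rewrite !inE !negb_or -!andbA => /and4P[/negPf n1 /negPf n2 /negPf n3 /negPf n4];
    rewrite /f n1 n2 n3 n4.
have fseen v : v \notin [set x1; x2; x3; x4] -> seen f v = seen c v.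
  by move=> vX; apply: eq_seen => m; apply: fX.
have tE1 a b z := @triE 5 _ _ _ a b z u1; have tE2 a b z := @triE 5 _ _ _ a b z u2.
have tE3 a b z := @triE 5 _ _ _ a b z u3; have tE4 a b z := @triE 5 _ _ _ a b z u4.
have tE := (tE1, tE2, tE3, tE4).
have safe1 : safe s f (x1, i1).
  move=> b; rewrite /= (fseen u uX) (seen_tri u1 f1) !inE f1 !tE -orbA.
  by case/or3P=> /eqP->; rewrite ?(negPf ru) ?(negPf r1u).
have safe4 : safe s f (x4, j4).
  move=> b; rewrite /= (fseen w wX) (seen_tri u4 f4) !inE f4 !tE -orbA.
  by case/or3P=> /eqP->; rewrite ?(negPf rw) ?(negPf r1w).
have safe2 : safe s f (x2, j2).
  move=> b; rewrite s23 /= (seen_tri u2 f2) (seen_tri u3 f3) !inE f2 !tE -!orbA.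
  case/or3P=> /eqP-> //; rewrite ?[r == _]eq_sym.
    by rewrite (negPf tr) (negPf ne_r) (negPf b3r).
  by rewrite (eq_sym _ b3) (negPf b2t) (negPf b2r') (negPf b3b).
have safe3 : safe s f (x3, i3).
  by apply: safe_flip => //; rewrite s32 // f3 f2 !tE.
exists f; apply: (safe_gluing ps cc) => // [[y m]|y|[y m] [y' n]|[y m]]; rewrite !inE -!orbA.
- case/or4P=> /= /eqP->.
  + case: (ord3_cases m u1) => ->; rewrite ?s12 ?sl1 ?f1 ?f2 ?tE //; exact: fX.
  + by case: (ord3_cases m u2) => ->; rewrite ?s21 ?s23 ?sl2 ?f1 ?f2 ?f3 ?tE.
  + by case: (ord3_cases m u3) => ->; rewrite ?s32 ?s34 ?sl3 ?f2 ?f3 ?f4 ?tE.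
  + case: (ord3_cases m u4) => ->; rewrite ?s43 ?sl4 ?f3 ?f4 ?tE //; exact: fX.
- case/or4P=> /= /eqP-> m n; rewrite ?f1 ?f2 ?f3 ?f4;
    [apply: (tri_inj u1)|apply: (tri_inj u2)|apply: (tri_inj u3)|apply: (tri_inj u4)];
    by apply: uniq3; rewrite // eq_sym.
- move=> /and5P[/= /eqP <- mn lm ln zz] /or4P[] /eqP vy; move: lm ln mn {zz}; rewrite {}vy.
  + case: (ord3_cases m u1) => ->; rewrite /linked ?sl1 ?eqxx //; first by left.
    by case: (ord3_cases n u1) => ->; rewrite ?sl1 ?eqxx //; right.
  + case: (ord3_cases m u2) => ->; rewrite /linked ?sl2 ?eqxx //; last by left.
    by case: (ord3_cases n u2) => ->; rewrite ?sl2 ?eqxx //; right.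
  + case: (ord3_cases m u3) => ->; rewrite /linked ?sl3 ?eqxx //; first by left.
    by case: (ord3_cases n u3) => ->; rewrite ?sl3 ?eqxx //; right.
  + case: (ord3_cases m u4) => ->; rewrite /linked ?sl4 ?eqxx //; last by left.
    by case: (ord3_cases n u4) => ->; rewrite ?sl4 ?eqxx //; right.
- case/or4P=> /= /eqP->.
  + by case: (ord3_cases m u1) => ->; rewrite ?s12 ?sl1 ?eqxx ?orbT.
  + by case: (ord3_cases m u2) => ->; rewrite ?s21 ?s23 ?sl2 ?eqxx ?orbT.
  + by case: (ord3_cases m u3) => ->; rewrite ?s32 ?s34 ?sl3 ?eqxx ?orbT.
  + by case: (ord3_cases m u4) => ->; rewrite ?s43 ?sl4 ?eqxx ?orbT.
Qed.

Lemma square_extends (c : dart -> 'I_5) x1 x2 x3 x4 (i1 j1 l1 i2 j2 l2 i3 j3 l3 i4 j4 l4 : 'I_3) :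
  uniq [:: x1; x2; x3; x4] ->
  uniq [:: i1; j1; l1] -> uniq [:: i2; j2; l2] -> uniq [:: i3; j3; l3] -> uniq [:: i4; j4; l4] ->
  s (x1, l1) = (x1, l1) -> s (x2, l2) = (x2, l2) -> s (x3, l3) = (x3, l3) ->
  s (x4, l4) = (x4, l4) ->
  s (x1, j1) = (x2, i2) -> s (x2, j2) = (x3, i3) -> s (x3, j3) = (x4, i4) ->
  s (x4, j4) = (x1, i1) ->
  dart_coloring (cut s [set x1; x2; x3; x4]) c ->
  exists f : dart -> 'I_5, dart_coloring s f.
Proof.
move=> ux u1 u2 u3 u4 sl1 sl2 sl3 sl4 s12 s23 s34 s41 cc.
have s21 : s (x2, i2) = (x1, j1) by rewrite -s12 (pairingK ps).
have s32 : s (x3, i3) = (x2, j2) by rewrite -s23 (pairingK ps).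
have s43 : s (x4, i4) = (x3, j3) by rewrite -s34 (pairingK ps).
have s14 : s (x1, i1) = (x4, j4) by rewrite -s41 (pairingK ps).
move: ux; rewrite /= !inE !negb_or -!andbA => /and5P[x12 x13 x14 x23 /and3P[x24 x34 _]].
pose o m : 'I_5 := inord m.
have oE m n : m < 5 -> n < 5 -> (o m == o n) = (m == n).
  by move=> lm ln; rewrite -val_eqE /= !inordK.
(* No link leaves the cycle, so its edges can be colored 0, 1, 2, 3 in order. The pendant colors
   make the opposite edges [x1 x2] and [x3 x4] safe, which covers every vertex. *)
pose f d := if d.1 == x1 then tri i1 j1 (o 3) (o 0) (o 4) d.2 else
            if d.1 == x2 then tri i2 j2 (o 0) (o 1) (o 2) d.2 else
            if d.1 == x3 then tri i3 j3 (o 1) (o 2) (o 0) d.2 else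
            if d.1 == x4 then tri i4 j4 (o 2) (o 3) (o 4) d.2 else c d.
have f1 m : f (x1, m) = tri i1 j1 (o 3) (o 0) (o 4) m by rewrite /f /= eqxx.
have f2 m : f (x2, m) = tri i2 j2 (o 0) (o 1) (o 2) m by rewrite /f /= eqxx eq_sym (negPf x12).
have f3 m : f (x3, m) = tri i3 j3 (o 1) (o 2) (o 0) m.
  by rewrite /f /= eqxx !(eq_sym x3) (negPf x13) (negPf x23).
have f4 m : f (x4, m) = tri i4 j4 (o 2) (o 3) (o 4) m.
  by rewrite /f /= eqxx !(eq_sym x4) (negPf x14) (negPf x24) (negPf x34).
have fX d : d.1 \notin [set x1; x2; x3; x4] -> f d = c d.
  by rewrite !inE !negb_or -!andbA => /and4P[/negPf n1 /negPf n2 /negPf n3 /negPf n4];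
    rewrite /f n1 n2 n3 n4.
have tE1 a b z := @triE 5 _ _ _ a b z u1; have tE2 a b z := @triE 5 _ _ _ a b z u2.
have tE3 a b z := @triE 5 _ _ _ a b z u3; have tE4 a b z := @triE 5 _ _ _ a b z u4.
have tE := (tE1, tE2, tE3, tE4).
have safe1 : safe s f (x1, j1).
  move=> b; rewrite s12 /= (seen_tri u1 f1) (seen_tri u2 f2) !inE f1 !tE -!orbA.
  by case/or3P=> /eqP-> //; rewrite !oE.
have safe3 : safe s f (x3, j3).
  move=> b; rewrite s34 /= (seen_tri u3 f3) (seen_tri u4 f4) !inE f3 !tE -!orbA.
  by case/or3P=> /eqP-> //; rewrite !oE.
have safe2 : safe s f (x2, i2).
  by apply: safe_flip => //; rewrite s21 // f1 f2 !tE.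
have safe4 : safe s f (x4, i4).
  by apply: safe_flip => //; rewrite s43 // f4 f3 !tE.
exists f; apply: (safe_gluing ps cc) => // [[y m]|y|[y m] [y' n]|[y m]]; rewrite !inE -!orbA.
- case/or4P=> /= /eqP->.
  + by case: (ord3_cases m u1) => ->; rewrite ?s12 ?s14 ?sl1 ?f1 ?f2 ?f4 ?tE.
  + by case: (ord3_cases m u2) => ->; rewrite ?s21 ?s23 ?sl2 ?f1 ?f2 ?f3 ?tE.
  + by case: (ord3_cases m u3) => ->; rewrite ?s32 ?s34 ?sl3 ?f2 ?f3 ?f4 ?tE.
  + by case: (ord3_cases m u4) => ->; rewrite ?s43 ?s41 ?sl4 ?f3 ?f4 ?f1 ?tE.
- by case/or4P=> /= /eqP-> m n; rewrite ?f1 ?f2 ?f3 ?f4;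
    [apply: (tri_inj u1)|apply: (tri_inj u2)|apply: (tri_inj u3)|apply: (tri_inj u4)];
    apply: uniq3; rewrite oE.
- move=> /and5P[/= /eqP <- mn lm ln zz] /or4P[] /eqP vy; move: lm ln mn {zz}; rewrite {}vy.
  + case: (ord3_cases m u1) => ->; rewrite /linked ?sl1 ?eqxx //; last by left.
    by case: (ord3_cases n u1) => ->; rewrite ?sl1 ?eqxx //; right.
  + case: (ord3_cases m u2) => ->; rewrite /linked ?sl2 ?eqxx //; first by left.
    by case: (ord3_cases n u2) => ->; rewrite ?sl2 ?eqxx //; right.
  + case: (ord3_cases m u3) => ->; rewrite /linked ?sl3 ?eqxx //; last by left.
    by case: (ord3_cases n u3) => ->; rewrite ?sl3 ?eqxx //; right.
  + case: (ord3_cases m u4) => ->; rewrite /linked ?sl4 ?eqxx //; first by left.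
    by case: (ord3_cases n u4) => ->; rewrite ?sl4 ?eqxx //; right.
- case/or4P=> /= /eqP->.
  + by case: (ord3_cases m u1) => ->; rewrite ?s12 ?s14 ?sl1 ?eqxx ?orbT.
  + by case: (ord3_cases m u2) => ->; rewrite ?s21 ?s23 ?sl2 ?eqxx ?orbT.
  + by case: (ord3_cases m u3) => ->; rewrite ?s32 ?s34 ?sl3 ?eqxx ?orbT.
  + by case: (ord3_cases m u4) => ->; rewrite ?s43 ?s41 ?sl4 ?eqxx ?orbT.
Qed.

Lemma triangle_extends (c : dart -> 'I_5) x1 x2 x3 (i1 j1 l1 i2 j2 l2 i3 j3 l3 : 'I_3) :
  uniq [:: x1; x2; x3] ->
  uniq [:: i1; j1; l1] -> uniq [:: i2; j2; l2] -> uniq [:: i3; j3; l3] ->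
  s (x1, l1) = (x1, l1) -> s (x2, l2) = (x2, l2) -> s (x3, l3) = (x3, l3) ->
  s (x1, j1) = (x2, i2) -> s (x2, j2) = (x3, i3) -> s (x3, j3) = (x1, i1) ->
  dart_coloring (cut s [set x1; x2; x3]) c ->
  exists f : dart -> 'I_5, dart_coloring s f.
Proof.
move=> ux u1 u2 u3 sl1 sl2 sl3 s12 s23 s31 cc.
have s21 : s (x2, i2) = (x1, j1) by rewrite -s12 (pairingK ps).
have s32 : s (x3, i3) = (x2, j2) by rewrite -s23 (pairingK ps).
have s13 : s (x1, i1) = (x3, j3) by rewrite -s31 (pairingK ps).
move: ux; rewrite /= !inE !negb_or -!andbA => /and4P[x12 x13 x23 _].
pose o m : 'I_5 := inord m.
have oE m n : m < 5 -> n < 5 -> (o m == o n) = (m == n).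
  by move=> lm ln; rewrite -val_eqE /= !inordK.
(* The edges get 0, 1, 2. Edges cannot alternate on an odd cycle, but it is enough that [x1 x2] and
   [x2 x3] are safe: every vertex lies on one of them. *)
pose f d := if d.1 == x1 then tri i1 j1 (o 2) (o 0) (o 3) d.2 else
            if d.1 == x2 then tri i2 j2 (o 0) (o 1) (o 4) d.2 else
            if d.1 == x3 then tri i3 j3 (o 1) (o 2) (o 3) d.2 else c d.
have f1 m : f (x1, m) = tri i1 j1 (o 2) (o 0) (o 3) m by rewrite /f /= eqxx.
have f2 m : f (x2, m) = tri i2 j2 (o 0) (o 1) (o 4) m by rewrite /f /= eqxx eq_sym (negPf x12).
have f3 m : f (x3, m) = tri i3 j3 (o 1) (o 2) (o 3) m.
  by rewrite /f /= eqxx !(eq_sym x3) (negPf x13) (negPf x23).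
have fX d : d.1 \notin [set x1; x2; x3] -> f d = c d.
  by rewrite !inE !negb_or -!andbA => /and3P[/negPf n1 /negPf n2 /negPf n3]; rewrite /f n1 n2 n3.
have tE1 a b z := @triE 5 _ _ _ a b z u1; have tE2 a b z := @triE 5 _ _ _ a b z u2.
have tE3 a b z := @triE 5 _ _ _ a b z u3; have tE := (tE1, tE2, tE3).
have safe1 : safe s f (x1, j1).
  move=> b; rewrite s12 /= (seen_tri u1 f1) (seen_tri u2 f2) !inE f1 !tE -!orbA.
  by case/or3P=> /eqP-> //; rewrite !oE.
have safe2 : safe s f (x2, j2).
  move=> b; rewrite s23 /= (seen_tri u2 f2) (seen_tri u3 f3) !inE f2 !tE -!orbA.
  by case/or3P=> /eqP-> //; rewrite !oE.
have safe3 : safe s f (x3, i3).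
  by apply: safe_flip => //; rewrite s32 // f2 f3 !tE.
exists f; apply: (safe_gluing ps cc) => // [[y m]|y|[y m] [y' n]|[y m]]; rewrite !inE -!orbA.
- case/or3P=> /= /eqP->.
  + by case: (ord3_cases m u1) => ->; rewrite ?s12 ?s13 ?sl1 ?f1 ?f2 ?f3 ?tE.
  + by case: (ord3_cases m u2) => ->; rewrite ?s21 ?s23 ?sl2 ?f1 ?f2 ?f3 ?tE.
  + by case: (ord3_cases m u3) => ->; rewrite ?s32 ?s31 ?sl3 ?f1 ?f2 ?f3 ?tE.
- by case/or3P=> /= /eqP-> m n; rewrite ?f1 ?f2 ?f3;
    [apply: (tri_inj u1)|apply: (tri_inj u2)|apply: (tri_inj u3)];
    apply: uniq3; rewrite oE.
- move=> /and5P[/= /eqP <- mn lm ln zz] /or3P[] /eqP vy; move: lm ln mn {zz}; rewrite {}vy.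
  + case: (ord3_cases m u1) => ->; rewrite /linked ?sl1 ?eqxx //; last by left.
    by case: (ord3_cases n u1) => ->; rewrite ?sl1 ?eqxx //; right.
  + case: (ord3_cases m u2) => ->; rewrite /linked ?sl2 ?eqxx //; last by left.
    by case: (ord3_cases n u2) => ->; rewrite ?sl2 ?eqxx //; right.
  + case: (ord3_cases m u3) => ->; rewrite /linked ?sl3 ?eqxx //; first by left.
    by case: (ord3_cases n u3) => ->; rewrite ?sl3 ?eqxx //; right.
- case/or3P=> /= /eqP->.
  + by case: (ord3_cases m u1) => ->; rewrite ?s12 ?s13 ?sl1 ?eqxx ?orbT.
  + by case: (ord3_cases m u2) => ->; rewrite ?s21 ?s23 ?sl2 ?eqxx ?orbT.
  + by case: (ord3_cases m u3) => ->; rewrite ?s32 ?s31 ?sl3 ?eqxx ?orbT.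
Qed.
End Reductions.

(** * Choice of colors around a claw with six colors *)

Definition apart (T : finType) (b a g b' a' g' : T) :=
  ~~ ((b' \in [set b; a; g]) && (b \in [set b'; a'; g'])).

Lemma apartC (T : finType) (b a g b' a' g' : T) :
  apart b a g b' a' g' = apart b' a' g' b a g.
Proof. by rewrite /apart andbC. Qed.

(** At the i-th leaf, [b] is the color of the claw edge, [g] that of the pendant edge, and [a] the
    prescribed color of the outward link, whose far end sees [W]. Avoiding [W] makes the outward
    link safe; [apart] excludes a clash at the center. *)
Definition claw_colorable (T : finType) (a1 a2 a3 : T) (W1 W2 W3 : {set T}) :=
  exists b1 b2 b3 g1 g2 g3,
    [/\ [/\ b1 \notin W1, b2 \notin W2 & b3 \notin W3],
        [/\ g1 \notin W1, g2 \notin W2 & g3 \notin W3],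
        [/\ g1 != b1, g2 != b2 & g3 != b3],
        [/\ b1 != b2, b1 != b3 & b2 != b3] &
        [/\ apart b1 a1 g1 b2 a2 g2, apart b1 a1 g1 b3 a3 g3 & apart b2 a2 g2 b3 a3 g3]].

Section ClawColors.

Implicit Types W : {set 'I_6}.

Lemma pick_outside W (r : seq 'I_6) : #|W| = 3 -> size r < 3 ->
  exists2 a, a \notin W & a \notin r.
Proof.
move=> W3 r3; have := cardsC W; rewrite W3 card_ord => cardC.
have [|a] := @pick_avoid _ (~: W) r; first by rewrite -(ltn_add2l 3) cardC.
by rewrite inE; exists a.
Qed.

(* A cyclic orientation of the claw in which each [b] avoids the whole
   triple of its predecessor. *)
Lemma claw_cycle a1 a2 a3 b1 b2 b3 W1 W2 W3 :
  #|W1| = 3 -> #|W2| = 3 -> #|W3| = 3 ->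
  b1 \notin W1 -> b2 \notin W2 -> b3 \notin W3 ->
  b1 != b2 -> b1 != b3 -> b2 != b3 ->
  b2 != a1 -> b3 != a2 -> b1 != a3 -> claw_colorable a1 a2 a3 W1 W2 W3.
Proof.
move=> w1 w2 w3 bW1 bW2 bW3 b12 b13 b23 ba1 ba2 ba3.
have [g1 gW1] := pick_outside w1 (isT : size [:: b1; b2] < 3).
have [g2 gW2] := pick_outside w2 (isT : size [:: b2; b3] < 3).
have [g3 gW3] := pick_outside w3 (isT : size [:: b3; b1] < 3).
rewrite !inE !negb_or => /andP[g3b g3b'] /andP[g2b g2b'] /andP[g1b g1b'].
exists b1, b2, b3, g1, g2, g3; split; split=> //; rewrite /apart !inE.
- by rewrite eq_sym (negPf b12) (negPf ba1) eq_sym (negPf g1b').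
- by rewrite andbC (negPf b13) (negPf ba3) eq_sym (negPf g3b').
- by rewrite eq_sym (negPf b23) (negPf ba2) eq_sym (negPf g2b').
Qed.

(** Outside each [W] there are three colors, so a choice can avoid two more. The color [b1], chosen
    last, has to avoid [b2], [b3] and [a3]; the last comes for free when [a3] is in [W1]. *)
Lemma claw_greedy a1 a2 a3 W1 W2 W3 :
  #|W1| = 3 -> #|W2| = 3 -> #|W3| = 3 -> a3 \in W1 -> claw_colorable a1 a2 a3 W1 W2 W3.
Proof.
move=> w1 w2 w3 aW.
have [b2 bW2] := pick_outside w2 (isT : size [:: a1] < 3).
have [b3 bW3] := pick_outside w3 (isT : size [:: a2; b2] < 3).
have [b1 bW1] := pick_outside w1 (isT : size [:: b2; b3] < 3).
rewrite !inE !negb_or => /andP[b12 b13] /andP[b3a b32] b2a.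
apply: (@claw_cycle a1 a2 a3 b1 b2 b3) => //; first by rewrite eq_sym.
by rewrite eq_sym; apply: mem_notin aW bW1.
Qed.

Lemma claw_rot a1 a2 a3 W1 W2 W3 :
  claw_colorable a1 a2 a3 W1 W2 W3 -> claw_colorable a2 a3 a1 W2 W3 W1.
Proof.
case=> [b1 [b2 [b3 [g1 [g2 [g3 [[? ? ?] [? ? ?] [? ? ?] [? ? ?] [? ? ?]]]]]]]].
by exists b2, b3, b1, g2, g3, g1; split; split; rewrite // 1?eq_sym 1?apartC.
Qed.

Lemma claw_flip a1 a2 a3 W1 W2 W3 :
  claw_colorable a1 a2 a3 W1 W2 W3 -> claw_colorable a1 a3 a2 W1 W3 W2.
Proof.
case=> [b1 [b2 [b3 [g1 [g2 [g3 [[? ? ?] [? ? ?] [? ? ?] [? ? ?] [? ? ?]]]]]]]].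
by exists b1, b3, b2, g1, g3, g2; split; split; rewrite // 1?eq_sym 1?apartC.
Qed.

(** If some [a] lies in the [W] of another leaf, a symmetry of the claw leads to the greedy case.
    Otherwise the three [a] are distinct and can be passed around: [b1 = a2], [b2 = a3],
    [b3 = a1]. *)
Lemma claw_colors a1 a2 a3 W1 W2 W3 :
  #|W1| = 3 -> #|W2| = 3 -> #|W3| = 3 ->
  a1 \in W1 -> a2 \in W2 -> a3 \in W3 -> claw_colorable a1 a2 a3 W1 W2 W3.
Proof.
move=> w1 w2 w3 aW1 aW2 aW3.
case: (boolP (a3 \in W1)) => [|n31]; first exact: claw_greedy.
case: (boolP (a1 \in W2)) => [|n12]; first by move=> ?; do 2 apply: claw_rot; exact: claw_greedy.
case: (boolP (a2 \in W3)) => [|n23]; first by move=> ?; apply: claw_rot; exact: claw_greedy.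
case: (boolP (a2 \in W1)) => [|n21]; first by move=> ?; apply: claw_flip; exact: claw_greedy.
case: (boolP (a3 \in W2)) => [|n32].
  by move=> ?; apply: claw_flip; apply: claw_rot; exact: claw_greedy.
case: (boolP (a1 \in W3)) => [|n13].
  by move=> ?; apply: claw_flip; do 2 apply: claw_rot; exact: claw_greedy.
have a12 := mem_notin aW1 n21; have a13 := mem_notin aW1 n31.
have a23 := mem_notin aW2 n32.
by apply: (@claw_cycle a1 a2 a3 a2 a3 a1); rewrite // eq_sym.
Qed.

End ClawColors.

(** * Reduction of adjacent two-link vertices and of claws with six colors *)

Section Reductions.

Variable V : finType.
Notation dart := (V * 'I_3)%type.

(* If the color of the pendant edge is seen at both neighbors of [u], then these two
   see at most five colors, and the pendant edge may take the sixth one. *)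
Lemma free_port (t : dart -> dart) (c : dart -> 'I_6) u m0 :
  pairing t -> dart_coloring t c -> t (u, m0) = (u, m0) ->
  exists (c' : dart -> 'I_6) m1 m2, [/\ dart_coloring t c', uniq [:: m0; m1; m2] &
    linked t (u, m2) -> c' (u, m0) \notin seen c' (t (u, m2)).1].
Proof.
move=> pt cc t0; have [m1 [m2 u3]] := ord3_others m0.
case: (boolP (linked t (u, m2) && (c (u, m0) \in seen c (t (u, m2)).1))); last first.
  by rewrite negb_and => nc; exists c, m1, m2; split=> // l2; rewrite l2 in nc.
case/andP=> l2 a2; have u3' : uniq [:: m0; m2; m1].
  by move: u3; rewrite /= !inE !negb_or !andbT (eq_sym m2) => /andP[/andP[-> ->] ->].
case: (boolP (linked t (u, m1) && (c (u, m0) \in seen c (t (u, m1)).1))); last first.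
  by rewrite negb_and => nc; exists c, m2, m1; split=> // l1; rewrite l1 in nc.
case/andP=> l1 a1; set S1 := seen c _ in a1; set S2 := seen c _ in a2.
have lt6 : #|S1 :|: S2| < 6.
  have: 0 < #|S1 :&: S2| by apply/card_gt0P; exists (c (u, m0)); rewrite inE a1.
  rewrite cardsU !(card_seen _ cc); case: #|_| => // n _.
  exact: leq_ltn_trans (leq_subr n 5) _.
have [|b] := @pick_color 6 (enum (S1 :|: S2)); first by rewrite -cardE.
rewrite mem_enum inE negb_or => /andP[bS1 bS2].
have [ct injc _] := cc.
have p1 : c (u, m1) \in S1 by rewrite -ct mem_seen.
have p2 : c (u, m2) \in S2 by rewrite -ct mem_seen.
have cc' : dart_coloring t (fun d => if d == (u, m0) then b else c d).
  apply: recolor => // [|m mm0|[v m] /= ->]; first by rewrite /linked t0 eqxx.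
    case: (ord3_cases m u3) mm0 => ->; rewrite ?eqxx // => _.
      exact: mem_notin p1 bS1.
    exact: mem_notin p2 bS2.
  by case: (ord3_cases m u3) => -> //; rewrite /linked t0 eqxx.
exists (fun d => if d == (u, m0) then b else c d), m1, m2; split=> // _; rewrite eqxx.
suff <- : S2 = seen (fun d => if d == (u, m0) then b else c d) (t (u, m2)).1 by [].
apply: eq_seen => m; case: eqP => // -[vu _].
by have := linked_ends pt l2; rewrite /= vu eqxx.
Qed.

Variable s : dart -> dart.
Hypothesis ps : pairing s.

(** The link [x2 w] is made safe, so clashes threaten only at [x1] and at [u]. At [u], the pair with
    port [m2] is settled by [free_port], and the one with port [m1] by keeping its color [p] out of
    the triple of [x1]. *)
Lemma thread2_extends (c0 : dart -> 'I_6) x1 x2 (i1 j1 l1 i2 j2 l2 : 'I_3) :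
  x1 != x2 -> uniq [:: i1; j1; l1] -> uniq [:: i2; j2; l2] ->
  s (x1, l1) = (x1, l1) -> s (x2, l2) = (x2, l2) -> s (x1, j1) = (x2, i2) ->
  (s (x1, i1)).1 \notin [set x1; x2] -> (s (x2, j2)).1 \notin [set x1; x2] ->
  dart_coloring (cut s [set x1; x2]) c0 ->
  exists f : dart -> 'I_6, dart_coloring s f.
Proof.
move=> x12 u1 u2 sl1 sl2 s12 uX wX.
case su: (s (x1, i1)) uX => [u m0] /= uX cc0.
have su' : s (u, m0) = (x1, i1) by rewrite -su (pairingK ps).
have [|c [m1 [m2 [cc um am]]]] := free_port (pairing_cut [set x1; x2] ps) cc0 (_ : _ (u, m0) = _).
  by rewrite /cut /= su' /= !inE eqxx orbT.
have s21 : s (x2, i2) = (x1, j1) by rewrite -s12 (pairingK ps).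
set w := (s (x2, j2)).1 in wX; set W := seen c w.
pose a := c (u, m0); pose a' := c (s (x2, j2)).
pose p := c (u, m1); pose q := c (u, m2).
have aW : a' \in W by apply: mem_seen.
have W3 : #|W| = 3 := card_seen w cc.
have [_ injc _] := cc.
have pa : p != a.
  by apply/eqP => /injc -/(_ erefl) [e]; move: um; rewrite /= e !inE eqxx.
(* At [x1] a clash needs [a] among [b], [a'], [g2] and [b] among [a], [p], [q]. If [a = a'], then
   [a] lies in [W] and is avoided for free, so [b] can avoid both [p] and [q]. Otherwise [b] avoids
   [a] and [p], and [b = q] is harmless because [a] is not seen at [x2]. *)
have [b [g2 [bW gW ba [bp ga gb abq]]]] : exists b g2,
    [/\ b \notin W, g2 \notin W, b != a & [/\ b != p, g2 != a, g2 != b & (a != a') || (b != q)]].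
  case: (eqVneq a a') => [aa | naa].
    have [b bW] := pick_outside W3 (isT : size [:: p; q] < 3).
    have [g gW] := pick_outside W3 (isT : size [:: b] < 3).
    rewrite !inE negb_or => gb /andP[bp bq]; exists b, g; split=> //; last split=> //.
      by rewrite eq_sym aa; apply: mem_notin bW.
    by rewrite eq_sym aa; apply: mem_notin gW.
  have [b bW] := pick_outside W3 (isT : size [:: a; p] < 3).
  have [g gW] := pick_outside W3 (isT : size [:: b; a] < 3).
  by rewrite !inE !negb_or => /andP[gb ga] /andP[ba bp]; exists b, g.
have [g1] := @pick_color 6 [:: a; b; p] isT; rewrite !inE !negb_or => /and3P[g1a g1b g1p].
have ab' : a' != b by apply: mem_notin aW bW.
have ag' : a' != g2 by apply: mem_notin aW gW.
pose f d := if d.1 == x1 then tri i1 j1 a b g1 d.2 else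
            if d.1 == x2 then tri i2 j2 b a' g2 d.2 else c d.
have f1 m : f (x1, m) = tri i1 j1 a b g1 m by rewrite /f /= eqxx.
have f2 m : f (x2, m) = tri i2 j2 b a' g2 m by rewrite /f /= eqxx eq_sym (negPf x12).
have fX d : d.1 \notin [set x1; x2] -> f d = c d.
  by rewrite !inE !negb_or => /andP[/negPf n1 /negPf n2]; rewrite /f n1 n2.
have fseen v : v \notin [set x1; x2] -> seen f v = seen c v.
  by move=> vX; apply: eq_seen => m; apply: fX.
have tE1 a b z := @triE 6 _ _ _ a b z u1; have tE2 a b z := @triE 6 _ _ _ a b z u2.
have tE := (tE1, tE2).
have safe2 : safe s f (x2, j2).
  move=> z; rewrite /= (fseen w wX) (seen_tri u2 f2) !inE f2 !tE -orbA.
  by case/or3P=> /eqP->; rewrite ?(negPf bW) ?(negPf gW).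
have injf v : v \in [set x1; x2] -> injective (fun i => f (v, i)).
  rewrite !inE => /orP[] /eqP-> m n; rewrite ?f1 ?f2;
    [apply: (tri_inj u1)|apply: (tri_inj u2)]; by apply: uniq3; rewrite // eq_sym.
have injf' d e : d.1 = e.1 -> f d = f e -> d = e.
  case: d e => [v m] [y n] /= <-; case: (boolP (v \in [set x1; x2])) => [/injf injv /injv -> //|vX].
  by rewrite !fX // => /injc; apply.
have fs d : d.1 \in [set x1; x2] -> f (s d) = f d.
  case: d => y m; rewrite !inE => /orP[] /= /eqP->.
    by case: (ord3_cases m u1) => ->; rewrite ?su ?s12 ?sl1 ?f1 ?f2 ?tE //; exact: fX.
  by case: (ord3_cases m u2) => ->; rewrite ?s21 ?sl2 ?f1 ?f2 ?tE //; exact: fX.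
have clash1 : ~~ clash s f (x1, j1) (x1, i1).
  rewrite /clash s12 su /= (seen_tri u2 f2) (fseen u uX) (seen3 _ _ um) !f1 !tE !inE.
  rewrite (eq_sym a b) (negPf ba) (eq_sym a g2) (negPf ga) /= orbF.
  by rewrite -/p -/q (negPf bp) negb_and.
exists f; apply: (recolored_gluing ps cc) => // d e de.
have /and5P[/eqP eq_de ne_de ld le _] := de.
have safe_pair : safe s f d \/ safe s f e -> ~~ clash s f d e.
  case=> sf; first exact: safe_no_clash.
  by rewrite clashC; apply: safe_no_clash; rewrite // eq_sym.
case: d e eq_de ne_de ld le {de} safe_pair => [v m] [y n] /= <- mn ld le safe_pair.
rewrite ![in X in X -> _]inE -orbA => /or3P[/eqP vx|/eqP vx|sdX].
- move: ld le mn {safe_pair}; rewrite {}vx.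
  case: (ord3_cases m u1) => ->; rewrite /linked ?sl1 ?eqxx //;
  case: (ord3_cases n u1) => ->; rewrite ?sl1 ?eqxx // => _ _ _.
  by rewrite clashC.
- apply: safe_pair; move: ld le mn; rewrite {}vx.
  case: (ord3_cases m u2) => ->; rewrite /linked ?sl2 ?eqxx //; last by left.
  by case: (ord3_cases n u2) => ->; rewrite ?sl2 ?eqxx //; right.
case sd: (s (v, m)) sdX => [y' n'] /= sdX.
have sd' : s (y', n') = (v, m) by rewrite -sd (pairingK ps).
have safe2' d : s d = (x2, j2) -> safe s f d.
  move=> sdx; apply: safe_flip => //; rewrite ?sdx //; symmetry.
  by have := fs (x2, j2); rewrite -sdx (pairingK ps) sdx !inE eqxx orbT; apply.
case/orP: sdX => /eqP yx; move: sd' sd; rewrite {}yx.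
  case: (ord3_cases n' u1) => ->; rewrite ?su ?s12 ?sl1 => -[vE mE] sd; last first.
  - by rewrite -vE -mE /linked sl1 eqxx in ld.
  - rewrite -vE -mE /linked in ld le mn safe_pair *.
    apply: safe_pair; move: le mn.
    case: (ord3_cases n u2) => ->; rewrite ?sl2 ?eqxx //; by right.
  rewrite -vE -mE in ld le mn safe_pair *.
  case: (ord3_cases n um) le mn safe_pair => ->; rewrite ?eqxx // => le _ safe_pair.
    apply/negP=> /andP[]; rewrite su' /= fX // (seen_tri u1 f1) !inE -/p.
    by rewrite (negPf pa) (eq_sym p b) (negPf bp) (eq_sym p g1) (negPf g1p).
  (* If this link of [u] also enters the cut set, then it ends at [x2] (a triangle) and is the safe
     link there. *)
  case: (boolP ((s (u, m2)).1 \in [set x1; x2])) => [sX | sX].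
    apply: safe_pair; right; apply: safe2'.
    case se: (s (u, m2)) sX => [y2 n2] /=; have se' : s (y2, n2) = (u, m2) by rewrite -se (pairingK ps).
    rewrite !inE => /orP[] /eqP yx; move: se' se; rewrite {}yx.
      case: (ord3_cases n2 u1) => ->; rewrite ?su ?s12 ?sl1.
      - by move=> [m02]; move: um; rewrite /= !inE m02 eqxx orbT.
      - by move=> [uE _]; rewrite -uE !inE eqxx orbT in uX.
      - by move=> [uE _]; rewrite -uE !inE eqxx in uX.
    case: (ord3_cases n2 u2) => -> //; rewrite ?s21 ?sl2.
    - by move=> [uE _]; rewrite -uE !inE eqxx in uX.
    - by move=> [uE _]; rewrite -uE !inE eqxx orbT in uX.
  have tm : cut s [set x1; x2] (u, m2) = s (u, m2) by rewrite /cut /= (negPf uX) (negPf sX).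
  apply/negP=> /andP[_]; rewrite fX // (fseen _ sX); apply/negP; rewrite -tm.
  by apply: am; rewrite /linked tm.
move=> + sd; case: (ord3_cases n' u2) => -> sd'.
- move: sd'; rewrite s21 => -[vE mE]; rewrite -vE -mE in ld le mn safe_pair *.
  move: ld le mn; case: (ord3_cases n u1) => ->; rewrite /linked ?sl1 ?eqxx //.
- by apply: safe_pair; left; apply: safe2'; rewrite -sd' (pairingK ps).
- by move: sd' ld; rewrite sl2 => <-; rewrite /linked sl2 eqxx.
Qed.

(** The outward links of the three leaves are safe, so only pairs at the center [v] remain, and
    these are settled by [apart]. *)
Lemma claw_extends (c : dart -> 'I_6) v x1 x2 x3 (m1 m2 m3 i1 j1 l1 i2 j2 l2 i3 j3 l3 : 'I_3) :
  uniq [:: v; x1; x2; x3] -> uniq [:: m1; m2; m3] ->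
  uniq [:: i1; j1; l1] -> uniq [:: i2; j2; l2] -> uniq [:: i3; j3; l3] ->
  s (x1, l1) = (x1, l1) -> s (x2, l2) = (x2, l2) -> s (x3, l3) = (x3, l3) ->
  s (v, m1) = (x1, i1) -> s (v, m2) = (x2, i2) -> s (v, m3) = (x3, i3) ->
  (s (x1, j1)).1 \notin [set v; x1; x2; x3] -> (s (x2, j2)).1 \notin [set v; x1; x2; x3] ->
  (s (x3, j3)).1 \notin [set v; x1; x2; x3] ->
  dart_coloring (cut s [set v; x1; x2; x3]) c ->
  exists f : dart -> 'I_6, dart_coloring s f.
Proof.
move=> ux u0 u1 u2 u3 sl1 sl2 sl3 sv1 sv2 sv3 yX1 yX2 yX3 cc.
have s1v : s (x1, i1) = (v, m1) by rewrite -sv1 (pairingK ps).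
have s2v : s (x2, i2) = (v, m2) by rewrite -sv2 (pairingK ps).
have s3v : s (x3, i3) = (v, m3) by rewrite -sv3 (pairingK ps).
set a1 := c (s (x1, j1)); set y1 := (s (x1, j1)).1 in yX1.
set a2 := c (s (x2, j2)); set y2 := (s (x2, j2)).1 in yX2.
set a3 := c (s (x3, j3)); set y3 := (s (x3, j3)).1 in yX3.
have aW1 : a1 \in seen c y1 by apply: mem_seen.
have aW2 : a2 \in seen c y2 by apply: mem_seen.
have aW3 : a3 \in seen c y3 by apply: mem_seen.
have := claw_colors (card_seen y1 cc) (card_seen y2 cc) (card_seen y3 cc) aW1 aW2 aW3.
case=> [b1 [b2 [b3 [g1 [g2 [g3 [[bW1 bW2 bW3] [gW1 gW2 gW3] [gb1 gb2 gb3]]]]]]]].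
move=> [b12 b13 b23] [ap12 ap13 ap23].
move: ux; rewrite /= !inE !negb_or -!andbA => /and5P[vx1 vx2 vx3 x12 /and3P[x13 x23 _]].
have ab1 : a1 != b1 by apply: mem_notin aW1 bW1.
have ab2 : a2 != b2 by apply: mem_notin aW2 bW2.
have ab3 : a3 != b3 by apply: mem_notin aW3 bW3.
have ag1 : a1 != g1 by apply: mem_notin aW1 gW1.
have ag2 : a2 != g2 by apply: mem_notin aW2 gW2.
have ag3 : a3 != g3 by apply: mem_notin aW3 gW3.
pose f d := if d.1 == v then tri m1 m2 b1 b2 b3 d.2 else
            if d.1 == x1 then tri i1 j1 b1 a1 g1 d.2 else
            if d.1 == x2 then tri i2 j2 b2 a2 g2 d.2 else
            if d.1 == x3 then tri i3 j3 b3 a3 g3 d.2 else c d.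
have f0 m : f (v, m) = tri m1 m2 b1 b2 b3 m by rewrite /f /= eqxx.
have f1 m : f (x1, m) = tri i1 j1 b1 a1 g1 m by rewrite /f /= eqxx eq_sym (negPf vx1).
have f2 m : f (x2, m) = tri i2 j2 b2 a2 g2 m.
  by rewrite /f /= eqxx !(eq_sym x2) (negPf vx2) (negPf x12).
have f3 m : f (x3, m) = tri i3 j3 b3 a3 g3 m.
  by rewrite /f /= eqxx !(eq_sym x3) (negPf vx3) (negPf x13) (negPf x23).
have fX d : d.1 \notin [set v; x1; x2; x3] -> f d = c d.
  by rewrite !inE !negb_or -!andbA => /and4P[/negPf n1 /negPf n2 /negPf n3 /negPf n4];
    rewrite /f n1 n2 n3 n4.
have fseen y : y \notin [set v; x1; x2; x3] -> seen f y = seen c y.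
  by move=> yX; apply: eq_seen => m; apply: fX.
have tE0 a b z := @triE 6 _ _ _ a b z u0; have tE1 a b z := @triE 6 _ _ _ a b z u1.
have tE2 a b z := @triE 6 _ _ _ a b z u2; have tE3 a b z := @triE 6 _ _ _ a b z u3.
have tE := (tE0, tE1, tE2, tE3).
have safe1 : safe s f (x1, j1).
  move=> b; rewrite /= (fseen y1 yX1) (seen_tri u1 f1) !inE f1 !tE -orbA.
  by case/or3P=> /eqP->; rewrite ?(negPf bW1) ?(negPf gW1).
have safe2 : safe s f (x2, j2).
  move=> b; rewrite /= (fseen y2 yX2) (seen_tri u2 f2) !inE f2 !tE -orbA.
  by case/or3P=> /eqP->; rewrite ?(negPf bW2) ?(negPf gW2).
have safe3 : safe s f (x3, j3).
  move=> b; rewrite /= (fseen y3 yX3) (seen_tri u3 f3) !inE f3 !tE -orbA.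
  by case/or3P=> /eqP->; rewrite ?(negPf bW3) ?(negPf gW3).
have fs d : d.1 \in [set v; x1; x2; x3] -> f (s d) = f d.
  case: d => y m; rewrite !inE -!orbA => /or4P[] /= /eqP->.
  - by case: (ord3_cases m u0) => ->; rewrite ?sv1 ?sv2 ?sv3 f0 ?f1 ?f2 ?f3 !tE.
  - by case: (ord3_cases m u1) => ->; rewrite ?s1v ?sl1 ?f0 ?f1 ?tE //; exact: fX.
  - by case: (ord3_cases m u2) => ->; rewrite ?s2v ?sl2 ?f0 ?f2 ?tE //; exact: fX.
  - by case: (ord3_cases m u3) => ->; rewrite ?s3v ?sl3 ?f0 ?f3 ?tE //; exact: fX.
have injf y : y \in [set v; x1; x2; x3] -> injective (fun i => f (y, i)).
  rewrite !inE -!orbA => /or4P[] /eqP-> m n; rewrite ?f0 ?f1 ?f2 ?f3;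
    [apply: (tri_inj u0)|apply: (tri_inj u1)|apply: (tri_inj u2)|apply: (tri_inj u3)];
    by apply: uniq3; rewrite // eq_sym.
have injf' d e : d.1 = e.1 -> f d = f e -> d = e.
  case: d e => [y m] [y' n] /= <-;
  case: (boolP (y \in [set v; x1; x2; x3])) => [/injf injy /injy -> //|yX].
  by have [_ injc _] := cc; rewrite !fX // => /injc; apply.
have clash12 : ~~ clash s f (v, m1) (v, m2).
  by rewrite /clash sv1 sv2 /= (seen_tri u1 f1) (seen_tri u2 f2) !f0 !tE.
have clash13 : ~~ clash s f (v, m1) (v, m3).
  by rewrite /clash sv1 sv3 /= (seen_tri u1 f1) (seen_tri u3 f3) !f0 !tE.
have clash23 : ~~ clash s f (v, m2) (v, m3).
  by rewrite /clash sv2 sv3 /= (seen_tri u2 f2) (seen_tri u3 f3) !f0 !tE.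
exists f; apply: (recolored_gluing ps cc) => // d e de.
have /and5P[/eqP eq_de ne_de ld le _] := de.
have safe_pair : safe s f d \/ safe s f e -> ~~ clash s f d e.
  case=> sf; first exact: safe_no_clash.
  by rewrite clashC; apply: safe_no_clash; rewrite // eq_sym.
have safe_out : d.1 \notin [set v; x1; x2; x3] -> (s d).1 \in [set v; x1; x2; x3] -> safe s f d.
  case sd: (s d) => [y m] /= dX yX; have sd' : s (y, m) = d by rewrite -sd (pairingK ps).
  apply: safe_flip; rewrite ?sd //; first by have := fs (y, m) yX; rewrite sd'.
  move: yX sd' dX; rewrite !inE -!orbA => /or4P[] /= /eqP-> <-.
  - by case: (ord3_cases m u0) => ->; rewrite ?sv1 ?sv2 ?sv3 eqxx ?orbT.
  - by case: (ord3_cases m u1) => ->; rewrite ?s1v ?sl1 ?eqxx ?orbT.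
  - by case: (ord3_cases m u2) => ->; rewrite ?s2v ?sl2 ?eqxx ?orbT.
  - by case: (ord3_cases m u3) => ->; rewrite ?s3v ?sl3 ?eqxx ?orbT.
case: (boolP (d.1 \in _)) => [dX _|dX]; last by move=> sdX; apply: safe_pair; left; apply: safe_out.
case: d e eq_de ne_de ld le {de safe_out} safe_pair dX => [y m] [y' n] /= <- mn ld le safe_pair.
rewrite !inE -!orbA => /or4P[] /eqP yx; move: mn ld le safe_pair; rewrite {}yx.
- case: (ord3_cases m u0) => ->; case: (ord3_cases n u0) => ->; rewrite ?eqxx // => _ _ _ _;
  by rewrite clashC.
- move=> mn ld le; apply; move: mn ld le.
  case: (ord3_cases m u1) => ->; rewrite /linked ?sl1 ?eqxx //; last by left.
  by case: (ord3_cases n u1) => ->; rewrite ?sl1 ?eqxx //; right.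
- move=> mn ld le; apply; move: mn ld le.
  case: (ord3_cases m u2) => ->; rewrite /linked ?sl2 ?eqxx //; last by left.
  by case: (ord3_cases n u2) => ->; rewrite ?sl2 ?eqxx //; right.
- move=> mn ld le; apply; move: mn ld le.
  case: (ord3_cases m u3) => ->; rewrite /linked ?sl3 ?eqxx //; last by left.
  by case: (ord3_cases n u3) => ->; rewrite ?sl3 ?eqxx //; right.
Qed.
End Reductions.

(** * Sparsity, induction on links, and the count for six colors *)

Section Counting.

Variable V : finType.
Notation dart := (V * 'I_3)%type.
Implicit Types (s : dart -> dart) (A X : {set V}).

Definition inner s A := [set d | [&& d.1 \in A, linked s d & (s d).1 \in A]].

(* [inner s A] contains two darts for each edge inside [A]. *)
Definition sparse p q s := forall A, A != set0 -> q * #|inner s A| < p * #|A|.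

Lemma linked_cut s X d : linked (cut s X) d -> linked s d /\ cut s X d = s d.
Proof. by rewrite /linked /cut; case: ifP => // _; rewrite eqxx. Qed.

Lemma inner_cut s X A : inner (cut s X) A \subset inner s A.
Proof.
apply/subsetP=> d; rewrite !inE => /and3P[dA /linked_cut[ld ->] sdA].
by rewrite dA ld.
Qed.

Lemma sparse_cut p q s X : sparse p q s -> sparse p q (cut s X).
Proof.
move=> sp A A0; apply: leq_ltn_trans (sp A A0); rewrite leq_mul2l.
by rewrite subset_leq_card ?orbT ?inner_cut.
Qed.

Lemma card_linked_cut s X d : d.1 \in X -> linked s d ->
  #|[set e | linked (cut s X) e]| < #|[set e | linked s e]|.
Proof.
move=> dX ld; apply/proper_card/properP; split.
  by apply/subsetP=> e; rewrite !inE => /linked_cut[].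
by exists d; rewrite inE // /linked /cut dX eqxx.
Qed.

Definition colorable k s := exists c : dart -> 'I_k, dart_coloring s c.

(** This replaces a minimal counterexample: a cut creates no link, and it destroys at least one if
    some link starts in [X]. *)
Lemma sparse_ind (P : (dart -> dart) -> Prop) p q :
  (forall s, pairing s -> sparse p q s ->
     (forall X d, d.1 \in X -> linked s d -> P (cut s X)) -> P s) ->
  forall s, pairing s -> sparse p q s -> P s.
Proof.
move=> step s; have [n] := ubnP #|[set e | linked s e]|.
elim: n s => // n IH s lt_n ps sp; apply: step => // X d dX ld.
apply: IH; [|exact: pairing_cut|exact: sparse_cut].
exact: leq_trans (card_linked_cut dX ld) _.
Qed.

Lemma unlinked_colorable k s : 2 < k -> (forall d, ~~ linked s d) -> colorable k s.
Proof.
move=> k3 unl; exists (fun d => widen_ord k3 d.2); split=> [d|[v i] [w j] /= ->|d e].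
- by have := unl d; rewrite negbK => /eqP->.
- by move/(congr1 val) => /= /val_inj ->.
- by case/and5P=> _ _ ld; have := unl d; rewrite ld.
Qed.

Definition darts_of s r := [set d | linked s d && (links s d.1 == r)].

Lemma card_darts_of s r : #|darts_of s r| = r * #|[set v | links s v == r]|.
Proof.
rewrite -!sum1dep_card big_distrr /= muln1.
rewrite (eq_bigl (fun d => (links s d.1 == r) && linked s (d.1, d.2))); last first.
  by case=> v i; rewrite andbC.
rewrite -(pair_big_dep (fun v => links s v == r) (fun v i => linked s (v, i)) (fun _ _ => 1)) /=.
by apply: eq_bigr => v /eqP <-; rewrite sum1dep_card.
Qed.

Lemma links_le3 s v : links s v <= 3.
Proof. by rewrite -[3]card_ord max_card. Qed.

Lemma links_gt0 s d : linked s d -> 0 < links s d.1.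
Proof. by case: d => v i ld; apply/card_gt0P; exists i; rewrite inE. Qed.

Lemma links23 s d : (forall v, links s v != 1) -> linked s d ->
  (d \in darts_of s 2) || (d \in darts_of s 3).
Proof.
move=> n1 ld; rewrite !inE ld /=; have := n1 d.1; have := links_gt0 ld.
by have := links_le3 s d.1; case: (links s d.1) => [|[|[|[|]]]].
Qed.

(** A vertex with links then has two or three, and every link joins two such vertices. Sparsity is
    applied to the set of all of them, which is empty only if there is no link. *)
Lemma sparse_count p q s : pairing s -> sparse p q s -> (forall v, links s v != 1) ->
  (forall d, ~~ linked s d) \/
  q * (#|darts_of s 2| + #|darts_of s 3|) <
    p * (#|[set v | links s v == 2]| + #|[set v | links s v == 3]|).
Proof.
move=> ps sp n1; pose A := [set v | links s v == 2] :|: [set v | links s v == 3].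
have cA : #|A| = #|[set v | links s v == 2]| + #|[set v | links s v == 3]|.
  rewrite /A cardsU (_ : _ :&: _ = set0) ?cards0 ?subn0 //.
  by apply/setP=> v; rewrite !inE; case: eqP => // ->.
have lA d : linked s d -> d.1 \in A.
  by move=> ld; have := links23 n1 ld; rewrite !inE ld.
case: (eqVneq A set0) => [A0 | /sp]; [left=> d | rewrite cA => lt; right].
  by apply/negP=> /lA; rewrite A0 inE.
apply: leq_ltn_trans lt; rewrite leq_mul2l; apply/orP; right.
have -> : #|darts_of s 2| + #|darts_of s 3| = #|darts_of s 2 :|: darts_of s 3|.
  rewrite cardsU (_ : _ :&: _ = set0) ?cards0 ?subn0 //.
  by apply/setP=> d; rewrite !inE; case: eqP => [->|]; rewrite ?andbF.
apply/subset_leq_card/subsetP=> d; rewrite inE => dd.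
have ld : linked s d by move: dd; rewrite !inE => /orP[] /andP[].
by rewrite inE ld !lA // linked_edge.
Qed.

Definition digon_free s := forall x i j, links s x = 2 -> i != j ->
  linked s (x, i) -> linked s (x, j) -> (s (x, i)).1 != (s (x, j)).1.

Lemma reduce_small k s : 4 < k -> pairing s ->
  (forall X d, d.1 \in X -> linked s d -> colorable k (cut s X)) ->
  colorable k s \/ ((forall v, links s v != 1) /\ digon_free s).
Proof.
move=> k5 ps IH.
case: (boolP [exists v, links s v == 1]) => [/existsP[y /eqP y1]|/existsPn n1].
  left; have : 0 < links s y by rewrite y1.
  case/card_gt0P=> i; rewrite inE => li.
  have [|c cc] := IH [set y] (y, i) _ li; first by rewrite inE.
  by apply: (pendant_extends ps k5 _ li cc); rewrite y1.
case: (boolP [exists x, exists i, exists j, [&& links s x == 2, i != j,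
  linked s (x, i), linked s (x, j) & (s (x, i)).1 == (s (x, j)).1]]).
  case/existsP=> x /existsP[i /existsP[j /and5P[/eqP x2 ij li lj /eqP sij]]].
  left; have [|c cc] := IH [set (s (x, i)).1; x] (x, i) _ li; first by rewrite !inE eqxx orbT.
  exact: (digon_extends ps k5 x2 ij li lj sij cc).
move=> nd; right; split=> // x i j x2 ij li lj; apply: contraNneq nd => sij.
by apply/existsP; exists x; apply/existsP; exists i; apply/existsP; exists j;
  rewrite x2 ij li lj sij !eqxx.
Qed.

Section SixColors.
Variable s : dart -> dart.
Hypothesis ps : pairing s.
Hypothesis IH : forall X d, d.1 \in X -> linked s d -> colorable 6 (cut s X).
Hypothesis nd : digon_free s.

Lemma adjacent2_colorable d : d \in darts_of s 2 -> s d \in darts_of s 2 -> colorable 6 s.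
Proof.
case: d => x1 j1; rewrite !inE /= => /andP[lj1 /eqP x1_2].
case s12: (s (x1, j1)) => [x2 i2] /andP[li2 /eqP /= x2_2].
have [i1 [l1 [u1 li1 sl1]]] := ports2 x1_2 lj1.
have [j2 [l2 [u2 lj2 sl2]]] := ports2 x2_2 li2.
have s21 : s (x2, i2) = (x1, j1) by rewrite -s12 (pairingK ps).
have x12 : x1 != x2 by have := linked_ends ps lj1; rewrite s12 eq_sym.
have [|c cc] := IH (X := [set x1; x2]) _ lj1; first by rewrite !inE eqxx.
have u1' : uniq [:: i1; j1; l1] by rewrite uniq_swap3.
apply: (thread2_extends ps x12 u1' u2 sl1 sl2 s12 _ _ cc); rewrite !inE negb_or.
  rewrite (linked_ends ps li1) /=; have := nd x1_2 _ li1 lj1; rewrite s12; apply.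
  by move: u1'; rewrite /= inE negb_or => /andP[/andP[]].
rewrite (linked_ends ps lj2) andbT; have := nd x2_2 _ lj2 li2; rewrite s21; apply.
by move: u2; rewrite /= inE negb_or eq_sym => /andP[/andP[]].
Qed.

Lemma claw_colorable_graph v : (forall d, d \in darts_of s 2 -> s d \notin darts_of s 2) ->
  (forall i, s (v, i) \in darts_of s 2) -> colorable 6 s.
Proof.
move=> na v2.
have [m2 [m3 u0]] := ord3_others ord0; set m1 := ord0 in u0.
have lv i : linked s (v, i).
  by rewrite -linked_edge //; have := v2 i; rewrite inE => /andP[].
have := (v2 m1, v2 m2, v2 m3).
case s1: (s (v, m1)) => [x1 i1]; case s2: (s (v, m2)) => [x2 i2]; case s3: (s (v, m3)) => [x3 i3].
rewrite !inE /= => -[[/andP[li1 /eqP x1_2] /andP[li2 /eqP x2_2]] /andP[li3 /eqP x3_2]].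
have [j1 [l1 [u1 lj1 sl1]]] := ports2 x1_2 li1.
have [j2 [l2 [u2 lj2 sl2]]] := ports2 x2_2 li2.
have [j3 [l3 [u3 lj3 sl3]]] := ports2 x3_2 li3.
have s1' : s (x1, i1) = (v, m1) by rewrite -s1 (pairingK ps).
have s2' : s (x2, i2) = (v, m2) by rewrite -s2 (pairingK ps).
have s3' : s (x3, i3) = (v, m3) by rewrite -s3 (pairingK ps).
have vx i : (s (v, i)).1 != v by have := linked_ends ps (lv i).
have vx1 : x1 != v by have := vx m1; rewrite s1.
have vx2 : x2 != v by have := vx m2; rewrite s2.
have vx3 : x3 != v by have := vx m3; rewrite s3.
(* Two equal leaves would be a vertex with two parallel links to [v]. *)
have ends_neq x y i j m n : links s x = 2 -> linked s (x, i) -> linked s (y, j) ->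
    s (x, i) = (v, m) -> s (y, j) = (v, n) -> m != n -> x != y.
  move=> x2' li lj sx sy mn; apply/eqP=> xy; have ij : i != j.
    by apply: contraNneq mn => ij; move: sx; rewrite xy ij sy => -[->].
  by rewrite -xy in lj sy; have := nd x2' ij li lj; rewrite sx sy eqxx.
have := u0; rewrite /= !inE negb_or andbT => /andP[/andP[m12 m13] m23].
have x12 : x1 != x2 := ends_neq _ _ _ _ _ _ x1_2 li1 li2 s1' s2' m12.
have x13 : x1 != x3 := ends_neq _ _ _ _ _ _ x1_2 li1 li3 s1' s3' m13.
have x23 : x2 != x3 := ends_neq _ _ _ _ _ _ x2_2 li2 li3 s2' s3' m23.
(* The outer neighbor of a leaf is no leaf, as vertices with two links are not adjacent, and it is
   not [v], as there is no double edge at a leaf. *)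
have out x i j m l : links s x = 2 -> linked s (x, i) -> linked s (x, j) -> uniq [:: i; j; l] ->
    s (x, i) = (v, m) -> (s (x, j)).1 \notin [set v; x1; x2; x3].
  move=> x2' li lj u sx.
  have n2 y : links s y = 2 -> (s (x, j)).1 != y.
    move=> y2; have := na (x, j); rewrite !inE lj x2' eqxx linked_edge // lj => /(_ isT) /= ne.
    by apply: contraNneq ne => ->; rewrite y2.
  rewrite !inE !negb_or (n2 x1) ?(n2 x2) ?(n2 x3) // !andbT.
  have := nd x2' _ lj li; rewrite sx; apply.
  by move: u; rewrite /= inE negb_or eq_sym => /andP[/andP[]].
have [|c cc] := IH (X := [set v; x1; x2; x3]) _ (lv m1); first by rewrite !inE eqxx.
apply: (claw_extends ps _ u0 u1 u2 u3 sl1 sl2 sl3 s1 s2 s3 _ _ _ cc).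
- by rewrite /= !inE !negb_or !(eq_sym v) vx1 vx2 vx3 x12 x13 x23.
- exact: out x1_2 li1 lj1 u1 s1'.
- exact: out x2_2 li2 lj2 u2 s2'.
- exact: out x3_2 li3 lj3 u3 s3'.
Qed.

End SixColors.

Lemma sparse_colorable6 s : pairing s -> sparse 5 2 s -> colorable 6 s.
Proof.
move: s; apply: sparse_ind => s ps sp IH.
have [//|[n1 nd]] := reduce_small (isT : 4 < 6) ps IH.
case: (boolP [exists d, (d \in darts_of s 2) && (s d \in darts_of s 2)]).
  by case/existsP=> d /andP[]; apply: adjacent2_colorable.
move/existsPn=> na'; have {na'}na d : d \in darts_of s 2 -> s d \notin darts_of s 2.
  by move=> d2; have := na' d; rewrite d2.
case: (boolP [exists v, [forall i, s (v, i) \in darts_of s 2]]).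
  by case/existsP=> v /forallP; apply: claw_colorable_graph.
move/existsPn=> nc.
have [|] := sparse_count ps sp n1; first exact: unlinked_colorable.
(* With [n2] and [n3] vertices having two and three links: both links of the former end at the
   latter, each of which receives at most two, so [n2 <= n3]. Sparsity reads
   [2 (2 n2 + 3 n3) < 5 (n2 + n3)], that is [n3 < n2]. *)
have le2 : #|darts_of s 2| <= 2 * #|[set v | links s v == 3]|.
  have [sK _] := ps; rewrite -(card_imset _ (can_inj sK)).
  apply: (@leq_trans #|[set d | (links s d.1 == 3) && (s (d.1, d.2) \in darts_of s 2)]|).
    apply/subset_leq_card/subsetP=> _ /imsetP[d d2 ->].
    rewrite inE -surjective_pairing sK d2 andbT.
    have ld : linked s (s d) by rewrite linked_edge //; move: d2; rewrite inE => /andP[].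
    by have := links23 n1 ld; rewrite (negPf (na d d2)) inE ld.
  rewrite -!sum1dep_card big_distrr /= muln1.
  rewrite -(pair_big_dep (fun v => links s v == 3)
    (fun v i => s (v, i) \in darts_of s 2) (fun _ _ => 1)) /=.
  apply: leq_sum => v _; rewrite sum1dep_card -ltnS -[X in _ < X](card_ord 3).
  rewrite -cardsT; apply/proper_card; rewrite properE subsetT /=.
  have := nc v; rewrite negb_forall => /existsP[i ni].
  by apply/subsetPn; exists i; rewrite inE.
rewrite !card_darts_of in le2 *; lia.
Qed.

End Counting.

(** * Threads of two-link vertices and the count for five colors *)

Section FiveColors.

Variable V : finType.
Notation dart := (V * 'I_3)%type.
Variable s : dart -> dart.
Hypothesis ps : pairing s.

(** Meant for vertices with two links, where it is the other linked dart; [twin (s d)] is then one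
    step along a thread. The default only makes it total. *)
Definition twin d := odflt d [pick e : dart | [&& e.1 == d.1, e != d & linked s e]].

Lemma twinE x i j l : uniq [:: i; j; l] -> linked s (x, j) -> s (x, l) = (x, l) ->
  twin (x, i) = (x, j).
Proof.
move=> u lj sl; rewrite /twin; case: pickP => [[y m]|/(_ (x, j))] /=.
  case/and3P=> /eqP /= -> mi lm; move: mi lm; case: (ord3_cases m u) => ->; rewrite ?eqxx //.
  by rewrite /linked sl eqxx.
rewrite eqxx lj xpair_eqE eqxx andbT /=; move: u; rewrite /= !inE negb_or (eq_sym j).
by rewrite (eq_sym j i); case: (i != j).
Qed.

Lemma twinP d : d \in darts_of s 2 ->
  [/\ twin d \in darts_of s 2, (twin d).1 = d.1, twin d != d & twin (twin d) = d].
Proof.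
case: d => x i; rewrite !inE /= => /andP[li /eqP x2].
have [j [l [u lj sl]]] := ports2 x2 li.
have u' : uniq [:: j; i; l] by rewrite uniq_swap3.
rewrite (twinE u lj sl) (twinE u' li sl) /= lj x2; split=> //.
by move: u'; rewrite /= !inE negb_or xpair_eqE eqxx => /andP[/andP[]].
Qed.

Lemma next_inj : {in [set d | s d \in darts_of s 2] &, injective (fun d => twin (s d))}.
Proof.
move=> d e; rewrite !inE => d2 e2 eq_de.
have [_ _ _ td] := @twinP (s d) ltac:(by rewrite inE).
have [_ _ _ te] := @twinP (s e) ltac:(by rewrite inE).
by apply: (can_inj (pairingK ps)); rewrite -td eq_de te.
Qed.

(** From a dart at a vertex with two links, at most two steps [twin (s d)] along the thread lead to
    a dart whose other end has three links. Steps are injective, so each dart at a three-link vertex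
    accounts for at most three darts. *)
Lemma thread_count :
  (forall v, links s v != 1) ->
  (forall d, d \in darts_of s 2 -> s d \in darts_of s 2 ->
     s (twin (s d)) \in darts_of s 2 -> s (twin (s (twin (s d)))) \notin darts_of s 2) ->
  #|darts_of s 2| <= 3 * #|darts_of s 3|.
Proof.
move=> n1 no4; pose nxt d := twin (s d).
pose back (B : {set dart}) := [set d | [&& d \in darts_of s 2, s d \in darts_of s 2 & nxt d \in B]].
have le_back B : #|back B| <= #|B|.
  rewrite -(card_in_imset (f := nxt) (D := mem (back B))).
    apply/subset_leq_card/subsetP=> _ /imsetP[d + ->].
    by rewrite inE => /and3P[].
  move=> d e; rewrite !inE => /and3P[_ d2 _] /and3P[_ e2 _].
  by apply: next_inj; rewrite !inE.
pose B0 := [set d | (d \in darts_of s 2) && (s d \in darts_of s 3)].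
have le0 : #|B0| <= #|darts_of s 3|.
  rewrite -(card_imset _ (can_inj (pairingK ps))); apply/subset_leq_card/subsetP=> _ /imsetP[d + ->].
  by rewrite inE => /andP[].
have ends d : d \in darts_of s 2 -> (s d \in darts_of s 2) || (s d \in darts_of s 3).
  by rewrite inE => /andP[ld _]; apply: links23; rewrite ?linked_edge.
have sub : darts_of s 2 \subset B0 :|: (back B0 :|: back (back B0)).
  apply/subsetP=> d d2; have := ends d d2.
  case d3: (s d \in darts_of s 3); first by rewrite !in_setU [d \in B0]in_set d2 d3.
  rewrite orbF => sd2; have [e2 _ _ _] := twinP sd2.
  have dE B : (d \in back B) = (nxt d \in B) by rewrite in_set d2 sd2.
  have := ends _ e2; case e3: (s (twin (s d)) \in darts_of s 3).
    by move=> _; rewrite !in_setU dE [nxt d \in _]in_set /nxt e2 e3 /= orbT.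
  rewrite orbF => se2; have [f2 _ _ _] := twinP se2.
  have := ends _ f2; rewrite (negPf (no4 d d2 sd2 se2)) => /= f3.
  by rewrite !in_setU !dE [nxt d \in back B0]in_set
    [nxt (nxt d) \in _]in_set /nxt e2 se2 f2 f3 /= !orbT.
apply: leq_trans (subset_leq_card sub) _.
apply: leq_trans (leq_card_setU _ _) _; rewrite mulSn leq_add //.
apply: leq_trans (leq_card_setU _ _) _; rewrite mul2n -addnn leq_add //.
  exact: leq_trans (le_back _) le0.
exact: leq_trans (le_back _) (leq_trans (le_back _) le0).
Qed.

Hypothesis IH : forall (X : {set V}) d, d.1 \in X -> linked s d -> colorable 5 (cut s X).
Hypothesis nd : digon_free s.

(** The walk may close up. By [digon_free], vertices two apart on it are distinct, so the only
    possible coincidence is [x1 = x4], a triangle. If the outer link of [x4] is that of [x1], there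
    is a square; otherwise both outer links leave the four vertices. *)
Lemma thread4_colorable d : d \in darts_of s 2 -> s d \in darts_of s 2 ->
  s (twin (s d)) \in darts_of s 2 -> s (twin (s (twin (s d)))) \in darts_of s 2 ->
  colorable 5 s.
Proof.
case: d => x1 j1; rewrite inE /= => /andP[lj1 /eqP x1_2].
case s12: (s (x1, j1)) => [x2 i2]; rewrite inE /= => /andP[li2 /eqP /= x2_2].
have [j2 [l2 [u2 lj2 sl2]]] := ports2 x2_2 li2; rewrite (twinE u2 lj2 sl2).
case s23: (s (x2, j2)) => [x3 i3]; rewrite inE /= => /andP[li3 /eqP /= x3_2].
have [j3 [l3 [u3 lj3 sl3]]] := ports2 x3_2 li3; rewrite (twinE u3 lj3 sl3).
case s34: (s (x3, j3)) => [x4 i4]; rewrite inE /= => /andP[li4 /eqP /= x4_2].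
have [i1 [l1 [u1 li1 sl1]]] := ports2 x1_2 lj1.
rewrite uniq_swap3 in u1.
have [j4 [l4 [u4 lj4 sl4]]] := ports2 x4_2 li4.
have s21 : s (x2, i2) = (x1, j1) by rewrite -s12 (pairingK ps).
have s32 : s (x3, i3) = (x2, j2) by rewrite -s23 (pairingK ps).
have s43 : s (x4, i4) = (x3, j3) by rewrite -s34 (pairingK ps).
have x12 : x1 != x2 by have := linked_ends ps lj1; rewrite s12 eq_sym.
have x23 : x2 != x3 by have := linked_ends ps lj2; rewrite s23 eq_sym.
have x34 : x3 != x4 by have := linked_ends ps lj3; rewrite s34 eq_sym.
have port_neq (i j l : 'I_3) : uniq [:: i; j; l] -> i != j.
  by rewrite /= inE negb_or => /andP[/andP[]].
have x13 : x1 != x3 by have := nd x2_2 (port_neq _ _ _ u2) li2 lj2; rewrite s21 s23.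
have x24 : x2 != x4 by have := nd x3_2 (port_neq _ _ _ u3) li3 lj3; rewrite s32 s34.
case: (eqVneq x1 x4) => [x14 | x14].
  have i14 : i4 = i1.
    case: (ord3_cases i4 u1) => // iE; move: s43; rewrite -x14 iE ?s12 ?sl1.
      by case=> xE; rewrite xE eqxx in x23.
    by case=> xE; rewrite xE eqxx in x13.
  have [|c cc] := IH (X := [set x1; x2; x3]) _ lj1; first by rewrite !inE eqxx.
  apply: (triangle_extends ps _ u1 u2 u3 sl1 sl2 sl3 s12 s23 _ cc).
    by rewrite uniq3.
  by rewrite s34 x14 i14.
have [|c cc] := IH (X := [set x1; x2; x3; x4]) _ lj1; first by rewrite !inE eqxx.
have ux : uniq [:: x1; x2; x3; x4].
  by rewrite /= !inE !negb_or x12 x13 x14 x23 x24 x34.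
case: (eqVneq (s (x4, j4)) (x1, i1)) => [s41 | n41].
  exact: (square_extends ps ux u1 u2 u3 u4 sl1 sl2 sl3 sl4 s12 s23 s34 s41 cc).
apply: (thread4_extends ps ux u1 u2 u3 u4 sl1 sl2 sl3 sl4 s12 s23 s34 _ _ cc).
- rewrite !inE !negb_or (linked_ends ps li1) /=.
  have := nd x1_2 (port_neq _ _ _ u1) li1 lj1; rewrite s12 /= => -> /=.
  case su: (s (x1, i1)) => [y m] /=; have su' : s (y, m) = (x1, i1) by rewrite -su (pairingK ps).
  apply/andP; split; apply/eqP=> yE; move: su'; rewrite yE.
    case: (ord3_cases m u3) => ->; rewrite ?s32 ?s34 ?sl3 => -[xE _].
    + by rewrite xE eqxx in x12.
    + by rewrite xE eqxx in x14.
    + by rewrite xE eqxx in x13.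
  case: (ord3_cases m u4) => -> => [||]; rewrite ?s43 ?sl4.
  + by case=> xE; rewrite xE eqxx in x13.
  + by move/eqP; rewrite (negPf n41).
  + by case=> xE; rewrite xE eqxx in x14.
- rewrite !inE !negb_or (linked_ends ps lj4) andbT.
  have := nd x4_2 (port_neq _ _ _ u4) li4 lj4; rewrite s43 /= eq_sym => -> /=.
  rewrite andbT; case sw: (s (x4, j4)) => [y m] /=.
  have sw' : s (y, m) = (x4, j4) by rewrite -sw (pairingK ps).
  apply/andP; split; apply/eqP=> yE; move: sw'; rewrite yE.
    case: (ord3_cases m u1) => ->; rewrite ?s12 ?sl1.
    + by move=> s14; rewrite -s14 (pairingK ps) eqxx in n41.
    + by case=> xE; rewrite xE eqxx in x24.
    + by case=> xE; rewrite xE eqxx in x14.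
  case: (ord3_cases m u2) => ->; rewrite ?s21 ?s23 ?sl2 => -[xE _].
  + by rewrite xE eqxx in x14.
  + by rewrite xE eqxx in x34.
  + by rewrite xE eqxx in x24.
Qed.

End FiveColors.

Lemma sparse_colorable5 (V : finType) (s : V * 'I_3 -> V * 'I_3) :
  pairing s -> sparse 24 11 s -> colorable 5 s.
Proof.
move: s; apply: sparse_ind => s ps sp IH.
have [//|[n1 nd]] := reduce_small (isT : 4 < 5) ps IH.
case: (boolP [exists d, [&& d \in darts_of s 2, s d \in darts_of s 2,
    s (twin s (s d)) \in darts_of s 2 & s (twin s (s (twin s (s d)))) \in darts_of s 2]]).
  by case/existsP=> d /and4P[]; apply: thread4_colorable.
move/existsPn=> no4.
(* With [n2] and [n3] as numbers of vertices with two and three links, sparsity reads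
   [11 (2 n2 + 3 n3) < 24 (n2 + n3)], that is [9 n3 < 2 n2], against the thread count. *)
have [|] := sparse_count ps sp n1; first exact: unlinked_colorable.
have := thread_count ps n1; rewrite !card_darts_of => le9.
have {}le9 : 2 * #|[set v | links s v == 2]| <= 3 * (3 * #|[set v | links s v == 3]|).
  by apply: le9 => d d2 sd2 se2; have := no4 d; rewrite d2 sd2 se2.
lia.
Qed.

(** * Forests and four colors *)

Lemma four_colors (c1 c2 c3 c4 p : 'I_4) :
  c1 != c2 -> c1 != c3 -> c2 != c3 -> c1 != c4 -> c2 != c4 -> c3 != c4 ->
  [\/ p = c1, p = c2, p = c3 | p = c4].
Proof.
move=> n12 n13 n23 n14 n24 n34; have u4 : uniq [:: c1; c2; c3; c4].
  by rewrite /= !inE !negb_or n12 n13 n14 n23 n24 n34.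
have sub : {subset [:: c1; c2; c3; c4] <= enum 'I_4} by move=> x; rewrite mem_enum.
have : p \in [:: c1; c2; c3; c4].
  have [|_ ->] := uniq_min_size u4 sub; last by rewrite mem_enum.
  by rewrite -cardE card_ord.
by rewrite !inE => /or4P[] /eqP ->; [constructor 1|constructor 2|constructor 3|constructor 4].
Qed.

(** At a vertex z with colors [c1], [c2], [c3] and missing color [c4], the pendant edge of color
    [c1] is to end at a new vertex, with missing color [m]. That vertex must see [c1] and [c4], so
    [m] is [c2] or [c3]. As [p2] is [c1] or [c3] and [p3] is [c1] or [c2], the last hypothesis says
    that exactly one of them is [c1], which decides [m]. With both equalities [p2 = c3] and
    [p3 = c2] no [m] would do: hence the demand for exactly one in the invariant. *)
Lemma new_missing_color (c1 c2 c3 c4 p2 p3 : 'I_4) (L2 L3 : bool) :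
  c1 != c2 -> c1 != c3 -> c2 != c3 -> c1 != c4 -> c2 != c4 -> c3 != c4 ->
  (L2 -> p2 != c2 /\ p2 != c4) -> (L3 -> p3 != c3 /\ p3 != c4) ->
  (L2 -> L3 -> (p2 == c3) (+) (p3 == c2)) ->
  exists m x,
  [/\ uniq [:: c1; c4; x], m \notin [:: c1; c4; x],
    L2 -> (m == c2) (+) (p2 == c1) & L3 -> (m == c3) (+) (p3 == c1)].
Proof.
move=> n12 n13 n23 n14 n24 n34 h2 h3 h23.
have dec (p : 'I_4) : p = c1 \/ p <> c1 by case: (p =P c1); [left|right].
have fc p := four_colors p n12 n13 n23 n14 n24 n34.
pose neq := (negPf n12, negPf n13, negPf n23, negPf n14, negPf n24, negPf n34).
have neq' : (c2 == c1 = false) * (c3 == c1 = false) * (c3 == c2 = false) *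
  (c4 == c1 = false) * (c4 == c2 = false) * (c4 == c3 = false).
  by do ![split]; rewrite eq_sym neq.
have good2 : (L2 -> p2 <> c1) -> (L3 -> p3 = c1) -> exists m x,
  [/\ uniq [:: c1; c4; x], m \notin [:: c1; c4; x],
    L2 -> (m == c2) (+) (p2 == c1) & L3 -> (m == c3) (+) (p3 == c1)].
  move=> k2 k3; exists c2, c3; rewrite /= !inE !neq !neq' !eqxx; split=> // [/k2 /eqP/negPf -> //|/k3->].
  by rewrite eqxx.
have good3 : (L2 -> p2 = c1) -> (L3 -> p3 <> c1) -> exists m x,
  [/\ uniq [:: c1; c4; x], m \notin [:: c1; c4; x],
    L2 -> (m == c2) (+) (p2 == c1) & L3 -> (m == c3) (+) (p3 == c1)].
  move=> k2 k3; exists c3, c2; rewrite /= !inE !neq !neq' !eqxx; split=> // [/k2->|/k3 /eqP/negPf -> //].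
  by rewrite eqxx.
case: L2 h2 h23 good2 good3 => [/(_ isT)[q2 q2']|_] h23 good2 good3; last first.
  case: L3 {h3 h23} good2 good3 => good2 good3; last by apply: good2.
  by have [e|e] := dec p3; [apply: good2 | apply: good3].
case: L3 h3 h23 good2 good3 => [/(_ isT)[q3 q3'] /(_ isT isT) h23|_ _] good2 good3; last first.
  by have [e|e] := dec p2; [apply: good3 | apply: good2].
have [e2|n2] := dec p2.
  have /eqP e3 : p3 == c2 by rewrite e2 neq in h23.
  by apply: good3 => // _; rewrite e3; apply/eqP; rewrite neq'.
have e2 : p2 = c3 by case: (fc p2) q2 q2' n2 => ->; rewrite ?eqxx // => _ _ [].
have n3 : p3 != c2 by rewrite e2 eqxx in h23.
by apply: good2 => // _; case: (fc p3) q3 q3' n3 => ->; rewrite ?eqxx.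
Qed.

Section Forests.

Variable V : finType.
Notation dart := (V * 'I_3)%type.

(* [m v] is the color missing at [v]. *)
Definition missing_coloring (s : dart -> dart) (c : dart -> 'I_4) (m : V -> 'I_4) :=
  [/\ forall d, c (s d) = c d,
      forall d e, d.1 = e.1 -> c d = c e -> d = e,
      forall d, c d != m d.1,
      forall d, linked s d -> m (s d).1 != m d.1 &
      forall d e, d.1 = e.1 -> d != e -> linked s d -> linked s e ->
        (m (s d).1 == c e) (+) (m (s e).1 == c d)].

Lemma missing_coloringW s c m : missing_coloring s c m -> dart_coloring s c.
Proof.
case=> cs injc cm mm mc; split=> // d e /and5P[/eqP de ne_de ld le _].
apply/andP=> -[/seenP[i ei] /seenP[j ej]]; have := mc d e de ne_de ld le.
have := cm ((s e).1, j); have := cm ((s d).1, i); rewrite /= -ei -ej.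
by rewrite ![c _ == m _]eq_sym => /negPf-> /negPf->.
Qed.

Lemma pendant_missing s y c m : pairing s -> links s y = 1 ->
  missing_coloring (cut s [set y]) c m -> exists f g, missing_coloring s f g.
Proof.
move=> ps y1 [cs injc cm mm mc].
have : 0 < links s y by rewrite y1.
case/card_gt0P=> i; rewrite inE => li.
have [|j [l [u3 sj sl]]] := ports1 _ li; first by rewrite y1.
have := linked_ends ps li; case sy: (s (y, i)) => [z n1] /= zy.
have sz : s (z, n1) = (y, i) by rewrite -sy (pairingK ps).
have [n2 [n3 v3]] := ord3_others n1.
have end_y d : d != (z, n1) -> d.1 != y -> (s d).1 != y.
  move=> dz dy; apply/eqP; case sd: (s d) => [w n] /= wy.
  have sd' : s (y, n) = d by rewrite -wy -sd (pairingK ps).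
  move: dz dy; rewrite -sd'; case: (ord3_cases n u3) => ->; rewrite ?sy ?sj ?sl ?eqxx //.
have out_y d : d.1 != y -> d != (z, n1) -> cut s [set y] d = s d.
  by move=> dy dz; rewrite /cut !inE (negPf dy) (negPf (end_y _ dz dy)).
have := v3; rewrite /= !inE negb_or andbT => /andP[/andP[n12 n13] n23].
have zn (n n' : 'I_3) : n != n' -> (z, n) != (z, n') by rewrite xpair_eqE eqxx.
have cn n n' : n != n' -> c (z, n) != c (z, n').
  by apply: contraNneq => /injc -/(_ erefl) [->].
have t2 : cut s [set y] (z, n2) = s (z, n2) by rewrite out_y // zn // eq_sym.
have t3 : cut s [set y] (z, n3) = s (z, n3) by rewrite out_y // zn // eq_sym.
have l2E : linked (cut s [set y]) (z, n2) = linked s (z, n2) by rewrite /linked t2.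
have l3E : linked (cut s [set y]) (z, n3) = linked s (z, n3) by rewrite /linked t3.
have [] := @new_missing_color (c (z, n1)) (c (z, n2)) (c (z, n3)) (m z)
  (m (s (z, n2)).1) (m (s (z, n3)).1) (linked s (z, n2)) (linked s (z, n3)).
- exact: cn.
- exact: cn.
- exact: cn.
- exact: cm (z, n1).
- exact: cm (z, n2).
- exact: cm (z, n3).
- move=> l2; split; first by rewrite eq_sym -[c (z, n2)]cs t2; apply: cm.
  by have := mm (z, n2); rewrite l2E t2; apply.
- move=> l3; split; first by rewrite eq_sym -[c (z, n3)]cs t3; apply: cm.
  by have := mm (z, n3); rewrite l3E t3; apply.
- by move=> l2 l3; have := mc (z, n2) (z, n3) erefl (zn _ _ n23); rewrite l2E l3E t2 t3; apply.
move=> m' [x [ux mx p2 p3]].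
pose f d := if d.1 == y then tri i j (c (z, n1)) (m z) x d.2 else c d.
pose g v := if v == y then m' else m v.
have fy n : f (y, n) = tri i j (c (z, n1)) (m z) x n by rewrite /f /= eqxx.
have fc d : d.1 != y -> f d = c d by rewrite /f => /negPf->.
have gy : g y = m' by rewrite /g eqxx.
have gm v : v != y -> g v = m v by rewrite /g => /negPf->.
have tE := triE _ _ _ u3.
move: mx; rewrite !inE !negb_or => /and3P[mc1 mz mx].
exists f, g; split=> [d|d e|d|d|d e].
- case: (eqVneq d.1 y) => [|dy].
    case: d => [v n] /= ->; case: (ord3_cases n u3) => ->; rewrite ?sy ?sj ?sl //.
    by rewrite fc // fy !tE.
  case: (eqVneq d (z, n1)) => [->|dz]; first by rewrite sz fy fc // !tE.
  by rewrite !fc ?end_y // -(out_y d) // cs.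
- case: d e => [v n] [w n'] /= <-; case: (eqVneq v y) => [->|vy].
    by rewrite !fy => /(tri_inj u3 ux) ->.
  by rewrite !fc // => /injc; apply.
- case: (eqVneq d.1 y) => [|dy]; last by rewrite fc // gm // cm.
  case: d => [v n] /= ->; rewrite fy gy.
  by case: (ord3_cases n u3) => ->; rewrite !tE eq_sym.
- case: (eqVneq d.1 y) => [|dy ld].
    case: d => [v n] /= ->.
    case: (ord3_cases n u3) => ->; rewrite /linked ?sj ?sl ?eqxx // => _.
    by rewrite sy gy gm //= eq_sym.
  case: (eqVneq d (z, n1)) ld => [-> _|dz ld]; first by rewrite sz /= gy gm.
  rewrite !gm ?end_y //; have := mm d; rewrite /linked out_y //; exact.
wlog: d e / e != (z, n1).
  move=> wl; case: (eqVneq e (z, n1)) => [ez|]; last exact: wl.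
  move=> de ne_de ld le; rewrite addbC; have dz : d != (z, n1) by rewrite -ez.
  by apply: wl; rewrite // eq_sym.
move=> ez de ne_de ld le; case: (eqVneq d.1 y) => [dy|dy].
  case: d e {ez} de dy ne_de ld le => [v n] [w n'] /= <- vy; rewrite {}vy.
  case: (ord3_cases n u3) => ->; rewrite /linked ?sj ?sl ?eqxx //.
  by case: (ord3_cases n' u3) => ->; rewrite ?sj ?sl ?eqxx.
have ey : e.1 != y by rewrite -de.
case: (eqVneq d (z, n1)) => [dz|dz]; last first.
  rewrite !gm ?end_y // !fc //; have := mc d e de ne_de; rewrite /linked !out_y //.
  by apply.
case: e ez ey de ne_de le => [w n] ez ey; rewrite {}dz in dy ld * => /= zw.
rewrite -zw in ez ey *; rewrite sz gy /= !fc // gm ?end_y //.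
by case: (ord3_cases n v3) ez => ->; rewrite ?eqxx.
Qed.

Lemma sparse_colorable4 (s : dart -> dart) : pairing s -> sparse 2 1 s -> colorable 4 s.
Proof.
move=> ps sp; suff [f [g fg]] : exists f g, missing_coloring s f g.
  by exists f; apply: missing_coloringW fg.
move: s ps sp; apply: sparse_ind => s ps sp IH.
case: (boolP [exists v, links s v == 1]) => [/existsP[y /eqP y1]|/existsPn n1].
  have : 0 < links s y by rewrite y1.
  case/card_gt0P=> i; rewrite inE => li.
  have [|f [g fg]] := IH [set y] (y, i) _ li; first by rewrite inE.
  exact: pendant_missing fg.
(* With no one-link vertex, sparsity would read [2 n2 + 3 n3 < 2 (n2 + n3)]; hence no link is left,
   and each vertex uses its three port numbers as colors and misses the fourth. *)
have [unl|] := sparse_count ps sp n1; last by rewrite !card_darts_of; lia.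
exists (fun d => widen_ord (isT : 3 <= 4) d.2), (fun _ => ord_max);
  split=> [d|[v i] [w j] /= ->|d|d|d e].
- by have := unl d; rewrite negbK => /eqP->.
- by move/(congr1 val) => /= /val_inj ->.
- by rewrite -val_eqE /= neq_ltn ltn_ord.
- by move=> ld; have := unl d; rewrite ld.
- by move=> _ _ ld; have := unl d; rewrite ld.
Qed.

End Forests.

(** * From subcubic multigraphs to dart graphs and back *)

Section Multigraphs.

Variable G : multigraph.
Hypothesis G3 : subcubic G.
Notation dart := (vertex G * 'I_3)%type.
Implicit Types (v w : vertex G) (e f : edge G).

(** The rank of [e] among the edges at [v], below three by subcubicity. The ranks left over become
    pendant edges. *)
Definition port v e : 'I_3 := inord (index e (enum [set f | v \in ends f])).

Definition opposite v e := odflt v [pick w in ends e :\ v].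

Definition edge_at (d : dart) := [pick e | (d.1 \in ends e) && (port d.1 e == d.2)].

Definition flip (d : dart) : dart :=
  if edge_at d is Some e then (opposite d.1 e, port (opposite d.1 e) e) else d.

Lemma degree_le3 v : degree v <= 3.
Proof. exact: leq_trans (leq_bigmax v) G3. Qed.

Lemma port_inj v e f : v \in ends e -> v \in ends f -> port v e = port v f -> e = f.
Proof.
move=> ve vf /(congr1 val); have lt3 g : v \in ends g -> index g (enum [set h | v \in ends h]) < 3.
  move=> vg; apply: leq_trans (degree_le3 v); rewrite /degree cardE index_mem mem_enum.
  by rewrite inE.
rewrite /= !inordK ?lt3 // => eq_i.
have mem g : v \in ends g -> g \in enum [set h | v \in ends h] by rewrite mem_enum inE.
by rewrite -(nth_index e (mem _ ve)) eq_i nth_index ?mem.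
Qed.

Lemma opposite_ends v e : v \in ends e -> ends e = [set v; opposite v e] /\ opposite v e != v.
Proof.
move=> ve; have c2 := card_ends e; rewrite /opposite; case: pickP => [w|none] /=.
  rewrite !inE => /andP[wv we]; split=> //; apply/esym/eqP.
  by rewrite eqEcard cards2 c2 eq_sym wv andbT; apply/subsetP=> x; rewrite !inE => /orP[] /eqP ->.
have : #|ends e :\ v| = 0 by apply: eq_card0.
by have := cardsD1 v (ends e); rewrite c2 ve => + c0; rewrite c0.
Qed.

Lemma opposite_mem v e : v \in ends e -> opposite v e \in ends e.
Proof. by move=> ve; have [eE _] := opposite_ends ve; rewrite eE !inE eqxx orbT. Qed.

Lemma opposite_set2 v w e : v != w -> ends e = [set v; w] -> opposite v e = w.
Proof.
move=> vw eE; have ve : v \in ends e by rewrite eE !inE eqxx.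
have := opposite_mem ve; have [_ ov] := opposite_ends ve.
by rewrite eE !inE (negPf ov) => /eqP.
Qed.

Lemma oppositeK v e : v \in ends e -> opposite (opposite v e) e = v.
Proof.
by move=> ve; have [eE ov] := opposite_ends ve; apply: opposite_set2; rewrite // setUC.
Qed.

Lemma edge_at_port v e : v \in ends e -> edge_at (v, port v e) = Some e.
Proof.
move=> ve; rewrite /edge_at; case: pickP => [f /andP[/= vf /eqP pf]|/(_ e)].
  by rewrite (port_inj vf ve pf).
by rewrite /= ve eqxx.
Qed.

Lemma edge_atP d e : edge_at d = Some e -> d.1 \in ends e /\ d = (d.1, port d.1 e).
Proof.
rewrite /edge_at; case: pickP => // f /andP[df /eqP pf] [<-]; split=> //.
by rewrite pf -surjective_pairing.
Qed.

Lemma flip_port v e : v \in ends e ->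
  flip (v, port v e) = (opposite v e, port (opposite v e) e).
Proof. by move=> ve; rewrite /flip edge_at_port. Qed.

Lemma pairing_flip : pairing flip.
Proof.
split=> d; case dE: (edge_at d) => [e|]; try by rewrite /flip !dE.
  have [ve ->] := edge_atP dE.
  by rewrite !flip_port ?oppositeK // opposite_mem.
have [ve ->] := edge_atP dE; rewrite flip_port //= => od.
by have [_] := opposite_ends ve; rewrite od eqxx.
Qed.

(** The darts inside [A] come from incidences (edge, end) of the subgraph induced by [A], two for
    each edge, and [mad] bounds its average degree. *)
Lemma sparse_flip (p q : nat) : 0 < q -> (mad G < p%:R / q%:R)%R -> sparse p q flip.
Proof.
move=> q0 ltG A A0; pose B := [set e | ends e \subset A].
have le_inner : #|inner flip A| <= 2 * #|B|.
  pose P := [set u : edge G * vertex G | (u.1 \in B) && (u.2 \in ends u.1)].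
  have <- : #|P| = 2 * #|B|.
    rewrite -[LHS]sum1dep_card -(pair_big_dep (mem B) (fun e v => v \in ends e) (fun _ _ => 1)) /=.
    rewrite -sum1_card big_distrr /=; apply: eq_bigr => e _.
    by rewrite sum1_card card_ends.
  apply: leq_trans (leq_imset_card (fun u => (u.2, port u.2 u.1)) (mem P)).
  apply/subset_leq_card/subsetP=> d; rewrite inE => /and3P[dA ld fdA].
  case dE: (edge_at d) => [e|]; last by rewrite /linked /flip dE eqxx in ld.
  have [ve dP] := edge_atP dE; apply/imsetP; exists (e, d.1); rewrite // !inE ve andbT.
  have [-> _] := opposite_ends ve; rewrite /flip dE /= in fdA.
  by apply/subsetP=> x; rewrite !inE => /orP[] /eqP ->.
have A_gt0 : 0 < #|A| by rewrite card_gt0.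
have le_mad : ((2 * #|B|)%:R / #|A|%:R <= mad G)%R.
  apply: (@le_bigmax_cond _ _ _ _ (A, B)
    (fun H : {set vertex G} * {set edge G} => (H.1 != set0) && is_subgraph H.1 H.2)
    (fun H => (2 * #|H.2|)%:R / #|H.1|%:R)%R).
  by rewrite /= A0; apply/forall_inP=> e; rewrite inE.
apply: (@leq_ltn_trans (q * (2 * #|B|))); first by rewrite leq_mul2l le_inner orbT.
have := le_lt_trans le_mad ltG.
rewrite ltr_pdivrMr ?ltr0n // mulrAC ltr_pdivlMr ?ltr0n // -!natrM ltr_nat.
by rewrite mulnC.
Qed.

Lemma star_colorable_darts k : colorable k flip -> star_colorable G k.
Proof.
case=> c [cs injc clash_c].
have end0 e : exists v, v \in ends e.
  by apply/card_gt0P; rewrite card_ends.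
(* The color is read at an arbitrary end; invariance of [c] under [flip] makes the choice
   irrelevant. *)
pose col e := c (xchoose (end0 e), port (xchoose (end0 e)) e).
have colE v e : v \in ends e -> c (v, port v e) = col e.
  rewrite /col; move: (xchoose _) (xchooseP (end0 e)) => w we ve.
  case: (eqVneq v w) => [-> // | vw]; rewrite -[RHS]cs flip_port // (@opposite_set2 w v) //.
    by rewrite eq_sym.
  have [-> _] := opposite_ends we; move: ve; have [-> ow] := opposite_ends we.
  by rewrite !inE (negPf vw) => /eqP ->.
have prop e f v : v \in ends e -> v \in ends f -> e != f -> col e != col f.
  move=> ve vf; apply: contraNneq; rewrite -(colE v) // -(colE v f) // => /injc -/(_ erefl) [].
  by move=> /(port_inj ve vf) ->.
(* A bicolored path or cycle with consecutive edges [e0], [e1], [e2], [e3] clashes at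
   the common end of [e1] and [e2]. *)
have no_bi e0 e1 e2 e3 u v w : u \in ends e0 -> ends e1 = [set u; v] -> ends e2 = [set v; w] ->
    w \in ends e3 -> uniq [:: u; v; w] -> e0 != e1 -> e2 != e3 ->
    ~~ ((col e0 == col e2) && (col e1 == col e3)).
  move=> ue0 e1E e2E we3; rewrite /= !inE negb_or andbT => /andP[/andP[uv uw] vw] e01 e23.
  have ve1 : v \in ends e1 by rewrite e1E !inE eqxx orbT.
  have ve2 : v \in ends e2 by rewrite e2E !inE eqxx.
  have f1 : flip (v, port v e1) = (u, port u e1).
    by rewrite flip_port // (@opposite_set2 v u) 1?eq_sym // e1E setUC.
  have f2 : flip (v, port v e2) = (w, port w e2).
    by rewrite flip_port // (@opposite_set2 v w).
  have ne12 : port v e1 != port v e2.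
    apply: contraNneq uw => /(port_inj ve1 ve2) e12; move: e2E; rewrite -e12 e1E => /setP/(_ u).
    by rewrite !inE eqxx (negPf uv) /= => <-.
  have := clash_c (v, port v e1) (v, port v e2); rewrite /pair_at /clash /linked f1 f2 /=.
  rewrite !xpair_eqE eqxx (negPf uv) (eq_sym w) (negPf vw) uw ne12 /= => /(_ isT).
  rewrite !colE //; apply: contra => /andP[/eqP c02 /eqP c13].
  by rewrite -c02 c13 -(colE u e0) // -(colE w e3) // !(mem_seen c (_, _)).
(* Under a proper coloring two colors on consecutive edges must alternate; otherwise three
   consecutive edges have distinct colors. *)
have bi e0 e1 e2 e3 : col e0 != col e1 -> col e1 != col e2 -> col e2 != col e3 ->
    bicolored [ffun e => col e] [:: e0; e1; e2; e3] ->
    (col e0 == col e2) && (col e1 == col e3).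
  move=> n01 n12 n23; apply: contraTT => nc; rewrite /bicolored -ltnNge.
  have three x y z : x \in [:: e0; e1; e2; e3] -> y \in [:: e0; e1; e2; e3] ->
      z \in [:: e0; e1; e2; e3] -> uniq [:: col x; col y; col z] ->
      2 < #|[set [ffun e => col e] e | e in [:: e0; e1; e2; e3]]|.
    move=> xe ye ze u3; rewrite -[3]/(size [:: col x; col y; col z]) -(card_uniqP u3).
    apply/subset_leq_card/subsetP=> a; rewrite !inE => /or3P[] /eqP->; apply/imsetP;
      [exists x|exists y|exists z]; by rewrite ?ffunE.
  move: nc; rewrite negb_and => /orP[n02|n13].
    by apply: (three e0 e1 e2); last exact: uniq3; rewrite !inE eqxx ?orbT.
  by apply: (three e1 e2 e3); last exact: uniq3; rewrite !inE eqxx ?orbT.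
(* Only the three inner vertices [u], [v], [w] occur, so paths with four edges and cycles of length
   four are covered alike. *)
have not_bi e0 e1 e2 e3 u v w : uniq [:: e0; e1; e2; e3] -> uniq [:: u; v; w] ->
    u \in ends e0 -> ends e1 = [set u; v] -> ends e2 = [set v; w] -> w \in ends e3 ->
    ~~ bicolored [ffun e => col e] [:: e0; e1; e2; e3].
  rewrite [X in X -> _]/= !inE !negb_or -!andbA => /and5P[e01 _ _ e12 /and3P[_ e23 _]].
  move=> u3 ue0 e1E e2E we3.
  have [ue1 ve1] : u \in ends e1 /\ v \in ends e1 by rewrite e1E !inE !eqxx orbT.
  have [ve2 we2] : v \in ends e2 /\ w \in ends e2 by rewrite e2E !inE !eqxx orbT.
  apply: contra (no_bi _ _ _ _ _ _ _ ue0 e1E e2E we3 u3 e01 e23).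
  by apply: bi; [apply: (prop _ _ u)|apply: (prop _ _ v)|apply: (prop _ _ w)].
apply/existsP; exists [ffun e => col e]; apply/and3P; split.
- apply/forallP=> e; apply/forallP=> f; apply/implyP=> /andP[ef /set0Pn[v]].
  by rewrite inE !ffunE => /andP[ve vf]; apply: (prop e f v).
- apply/forallP=> v; apply/forallP=> e; apply/implyP=> path_e.
  have := path_uniq_edges path_e; case/andP: path_e => + /forallP eE.
  have := (eE (Ordinal (isT : 0 < 4)), eE (Ordinal (isT : 1 < 4)),
           eE (Ordinal (isT : 2 < 4)), eE (Ordinal (isT : 3 < 4))).
  case: v {eE} => -[|v0 [|v1 [|v2 [|v3 [|v4 [|]]]]]] //= ?.
  case: e => -[|e0 [|e1 [|e2 [|e3 [|]]]]] //= ?; rewrite !(tnth_nth v0) !(tnth_nth e0) /=.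
  case=> [[[/eqP E0 /eqP E1] /eqP E2] /eqP E3] uv ue.
  apply: (not_bi e0 e1 e2 e3 v1 v2 v3) => //; rewrite ?E0 ?E3 ?inE ?eqxx ?orbT //.
  exact: (@mask_uniq _ [:: v0; v1; v2; v3; v4] uv [:: false; true; true; true; false]).
- apply/forallP=> v; apply/forallP=> e; apply/implyP=> /and3P[+ + /forallP eE].
  have := (eE (Ordinal (isT : 0 < 4)), eE (Ordinal (isT : 1 < 4)),
           eE (Ordinal (isT : 2 < 4)), eE (Ordinal (isT : 3 < 4))).
  case: v {eE} => -[|v0 [|v1 [|v2 [|v3 [|]]]]] //= ?.
  case: e => -[|e0 [|e1 [|e2 [|e3 [|]]]]] //= ?; rewrite !(tnth_nth v0) !(tnth_nth e0) /=.
  case=> [[[/eqP E0 /eqP E1] /eqP E2] /eqP E3] uv ue.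
  apply: (not_bi e0 e1 e2 e3 v1 v2 v3) => //; rewrite ?E0 ?E3 ?inE ?eqxx ?orbT //.
  exact: (@mask_uniq _ [:: v0; v1; v2; v3] uv [:: false; true; true; true]).
Qed.

End Multigraphs.

(** * Tightness for four colors: a binary tree *)

Definition heap_ends (e : 'I_6) : {set 'I_7} := [set inord e.+1; inord e./2].

Lemma card_heap_ends e : #|heap_ends e| = 2.
Proof.
rewrite cards2 -val_eqE /= !inordK; last by have := ltn_ord e; lia.
  by case: eqP => //; have := ltn_ord e; lia.
by have := ltn_ord e; lia.
Qed.

(** The complete binary tree of depth two in heap order: edge [e] joins node [e + 1] to its parent,
    half of [e] rounded down. *)
Definition heap_tree := Multigraph card_heap_ends.

Lemma in_heap_ends (v : vertex heap_tree) (e : edge heap_tree) :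
  (v \in ends e) = (val v == e.+1) || (val v == e./2).
Proof.
have e6 := ltn_ord e; rewrite /= !inE -!val_eqE /= !inordK //; lia.
Qed.

Lemma heap_subcubic : subcubic heap_tree.
Proof.
apply/bigmax_leqP => v _; rewrite /degree.
(* Edge [v - 1] goes to the parent and edges [2 v], [2 v + 1] to the children. For the root or a
   leaf the list may contain other or repeated edges, harmless in an upper bound. *)
apply: leq_trans (card_size [:: inord v.-1; inord v.*2; inord v.*2.+1 : 'I_6]).
apply/subset_leq_card/subsetP=> e; rewrite inE in_heap_ends => ve; rewrite !inE.
have e6 := ltn_ord e.
have [ee|[ee|ee]] : val e = v.-1 \/ val e = v.*2 \/ val e = v.*2.+1.
- by case/orP: ve => /eqP /= ->; lia.
- by rewrite -ee inord_val eqxx.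
- by rewrite -ee inord_val eqxx orbT.
- by rewrite -ee inord_val eqxx !orbT.
Qed.

(** Mapping each edge to its child end is injective and misses the vertex of [A] with the least
    label, since parents have smaller labels; so a subgraph has fewer edges than vertices. *)
Lemma heap_mad : (mad heap_tree < 2)%R.
Proof.
apply: bigmax_lt => // -[A B] /= /andP[/set0Pn[v0 Av0] /forall_inP subA].
have A_gt0 : 0 < #|A| by apply/card_gt0P; exists v0.
rewrite ltr_pdivrMr ?ltr0n // -natrM ltr_nat ltn_pmul2l //.
case: (arg_minnP (fun v : 'I_7 => val v) Av0) => a aA min_a.
have {}aA : a \in A := aA; rewrite (cardsD1 a A) aA add1n ltnS.
have inj : injective (fun e : 'I_6 => inord e.+1 : 'I_7).
  move=> e f /(congr1 val) /=; rewrite !inordK ?ltnS ?leq_ord // => -[]; exact: val_inj.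
rewrite -(card_imset _ inj); apply/subset_leq_card/subsetP=> _ /imsetP[e eB ->].
have eA := subsetP (subA e eB); have e6 := ltn_ord e.
have p1 : inord e.+1 \in A by apply: eA; rewrite !inE eqxx.
have p2 : inord e./2 \in A by apply: eA; rewrite !inE eqxx orbT.
rewrite in_setD1 p1 andbT; apply: contraTneq (min_a _ p2) => <-.
by rewrite -ltnNge /= !inordK; lia.
Qed.

(* With three colors, both children of the root see all of them, so the color of
   either root edge reappears below the other child. *)
Lemma heap_not_colorable k : k <= 3 -> ~~ star_colorable heap_tree k.
Proof.
move=> k3; apply/existsP=> -[c /and3P[/forallP prop /forallP no_path _]].
pose o m : edge heap_tree := inord m : 'I_6.
pose n m : vertex heap_tree := inord m : 'I_7.
have oE m : m < 6 -> ends (o m) = [set n m.+1; n m./2].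
  by move=> m6; rewrite /= /heap_ends inordK.
have o_neq a b : a < 6 -> b < 6 -> a != b -> o a != o b.
  by move=> a6 b6; rewrite -val_eqE /= !inordK.
have n_eq a b : a < 7 -> b < 7 -> (n a == n b) = (a == b).
  by move=> a7 b7; rewrite -val_eqE /= !inordK.
have neq a b v : a < 6 -> b < 6 -> a != b -> n v \in ends (o a) -> n v \in ends (o b) ->
    c (o a) != c (o b).
  move=> a6 b6 ab va vb; have /forallP/(_ (o b))/implyP := prop (o a); apply.
  by rewrite o_neq //; apply/set0Pn; exists (n v); rewrite inE va.
have end1 m : m < 6 -> n m.+1 \in ends (o m) by move=> m6; rewrite oE // !inE eqxx.
have end2 m v : m < 6 -> m./2 = v -> n v \in ends (o m).
  by move=> m6 <-; rewrite oE // !inE eqxx orbT.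
have pigeon a b d e :
   c (o a) != c (o b) -> c (o a) != c (o d) -> c (o b) != c (o d) -> c (o e) != c (o a) ->
   c (o b) = c (o e) \/ c (o d) = c (o e).
  move=> ab ad bd ea.
  case: (c (o b) =P c (o e)) => [|/eqP be]; first by left.
  case: (c (o d) =P c (o e)) => [|/eqP de]; first by right.
  have u4 : uniq [:: c (o a); c (o b); c (o d); c (o e)].
    by rewrite /= !inE !negb_or ab ad bd be de eq_sym ea.
  have := max_card (mem [:: c (o a); c (o b); c (o d); c (o e)]).
  by rewrite (card_uniqP u4) card_ord /= => /leq_trans/(_ k3).
(* The path through nodes [i + 1], 1, 0, 2, [j + 1] has edges [i], 0, 1, [j], whose colors would
   alternate. *)
have bad i j : i \in [:: 2; 3] -> j \in [:: 4; 5] ->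
    c (o i) = c (o 1) -> c (o j) = c (o 0) -> False.
  move=> i23 j45 ci cj.
  have [i6 i2] : i < 6 /\ i./2 = 1 by move: i23; rewrite !inE => /orP[] /eqP->.
  have [j6 j2] : j < 6 /\ j./2 = 2 by move: j45; rewrite !inE => /orP[] /eqP->.
  have /forallP/(_ [tuple o i; o 0; o 1; o j])/implyP :=
    no_path [tuple n i.+1; n 1; n 0; n 2; n j.+1].
  case/(_ _)/negP.
    apply/andP; split.
      by move: i23 j45; rewrite !inE => /orP[] /eqP-> /orP[] /eqP->; rewrite /= !inE !n_eq.
    apply/forallP=> m; rewrite !(tnth_nth (o 0)) !(tnth_nth (n 0)).
    have hE e : e < 6 -> heap_ends (o e) = [set n e.+1; n e./2] by apply: oE.
    by case: m => -[|[|[|[|]]]] //= _; rewrite hE ?i2 ?j2 // setUC.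
  rewrite /bicolored; apply: (@leq_trans #|[set c (o 0); c (o 1)]|);
    last by rewrite cards2; case: (_ != _).
  apply/subset_leq_card/subsetP=> _ /imsetP[e + ->].
  by rewrite !inE => /or4P[] /eqP->; rewrite ?ci ?cj eqxx ?orbT.
have n01 : c (o 0) != c (o 1) by apply: (neq _ _ 0) => //; solve [exact: end2 | exact: end1].
have n02 : c (o 0) != c (o 2) by apply: (neq _ _ 1) => //; solve [exact: end2 | exact: end1].
have n03 : c (o 0) != c (o 3) by apply: (neq _ _ 1) => //; solve [exact: end2 | exact: end1].
have n23 : c (o 2) != c (o 3) by apply: (neq _ _ 1) => //; solve [exact: end2 | exact: end1].
have n14 : c (o 1) != c (o 4) by apply: (neq _ _ 2) => //; solve [exact: end2 | exact: end1].
have n15 : c (o 1) != c (o 5) by apply: (neq _ _ 2) => //; solve [exact: end2 | exact: end1].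
have n45 : c (o 4) != c (o 5) by apply: (neq _ _ 2) => //; solve [exact: end2 | exact: end1].
have n10 : c (o 1) != c (o 0) by rewrite eq_sym.
have [c2|c3] := pigeon 0 2 3 1 n02 n03 n23 n10;
have [c4|c5] := pigeon 1 4 5 0 n14 n15 n45 n01.
- exact: bad 2 4 isT isT c2 c4.
- exact: bad 2 5 isT isT c2 c5.
- exact: bad 3 4 isT isT c3 c4.
- exact: bad 3 5 isT isT c3 c5.
Qed.

Lemma star_chromatic_index_le (G : multigraph) k :
  star_colorable G k -> star_chromatic_index G <= k.
Proof. by rewrite /star_chromatic_index; case: ex_minnP => m _ min /min. Qed.

Theorem theorem1p6 :
  ((forall G : multigraph, subcubic G -> (mad G < 2)%R ->
      star_chromatic_index G <= 4) /\
   (exists G : multigraph,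
      [/\ subcubic G, (mad G < 2)%R & star_chromatic_index G = 4])) /\
  (forall G : multigraph, subcubic G -> (mad G < 24 / 11)%R ->
     star_chromatic_index G <= 5) /\
  (forall G : multigraph, subcubic G -> (mad G < 5 / 2)%R ->
     star_chromatic_index G <= 6).
Proof.
have forests (G : multigraph) : subcubic G -> (mad G < 2)%R -> star_chromatic_index G <= 4.
  move=> G3 ltG; apply/star_chromatic_index_le/(star_colorable_darts G3)/sparse_colorable4.
    exact: pairing_flip.
  by apply: sparse_flip; rewrite // divr1.
split; [split=> // | split=> G G3 ltG; apply/star_chromatic_index_le/(star_colorable_darts G3)].
- exists heap_tree; split; [exact: heap_subcubic | exact: heap_mad |].
  apply/eqP; rewrite eqn_leq forests ?heap_subcubic ?heap_mad //=.
  rewrite /star_chromatic_index; case: ex_minnP => m col_m _; rewrite ltnNge.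
  by apply: contraL col_m; apply: heap_not_colorable.
- by apply: sparse_colorable5; [apply: pairing_flip | apply: sparse_flip].
- by apply: sparse_colorable6; [apply: pairing_flip | apply: sparse_flip].
Qed.
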